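(* Let $d\ge 1$, let $\Lambda\subseteq\mathbb{Z}^d$ be finite, let $\beta>0$, let $H:\Omega_\Lambda=\{-1,1\}^\Lambda\to\mathbb{R}$, let $\lambda_i$ ($i\in\Lambda$) be real numbers, and let $C,\lambda,R>0$ be constants such that (BD) $\sup_{i\in\Lambda}\sup_{\sigma\in\Omega_\Lambda}|\nabla_i H(\sigma)|\le C$ and $0\le\lambda_i\le\lambda$ for all $i\in\Lambda$; (LOC) for every $i\in\Lambda$, $\nabla_i H(\sigma)=\nabla_i H(\eta)$ whenever $\sigma,\eta\in\Omega_\Lambda$ satisfy $\sigma_j=\eta_j$ for every $j\in\Lambda$ such that $|j-i|\le R$. Suppose that $\beta,\lambda$ are such that $$\gamma:=e^{-2\beta C}-5\max(1,\beta\lambda)(2R)^d\left(e^{3\beta C}-1\right)>0 .$$ Then for all $f,g:\Omega_\Lambda\to\mathbb{R}$, $$\left|\langle\mathcal{F}_f;\mathcal{F}_g\rangle\right|\le\left(\|f\|\,\|g\|+N\,|||f|||\;|||g|||\right)\exp\left[-\delta\,\operatorname{dist}(\Lambda_f,\Lambda_g)\right],$$ where $\operatorname{dist}(\Lambda_f,\Lambda_g):=\min\{|i-j|: i\in\Lambda_f,\ j\in\Lambda_g\}$ and $$N=\left(\frac{2}{1-e^{-1/R}}\right)^d,\qquad \delta:=\frac{1}{2R}\min\left(\frac12,\ \frac{\gamma}{10\max(1,\lambda\beta)\,e^{\beta C+1}}\right).$$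
   Context: Classical notation: $|\cdot|$ on $\mathbb{Z}^d$ is the $\ell^1$ norm. For $\sigma\in\Omega_\Lambda$ and $i\in\Lambda$, $\sigma^i$ is obtained from $\sigma$ by flipping the $i$-th spin, and $\nabla_i f(\sigma):=f(\sigma^i)-f(\sigma)$ for $f:\Omega_\Lambda\to\mathbb{R}$. Set $\|f\|:=\sup_{\sigma\in\Omega_\Lambda}|f(\sigma)|$, $|||f|||:=\sum_{i\in\Lambda}\|\nabla_i f\|$ and $\Lambda_f:=\{i\in\Lambda:\|\nabla_i f\|>0\}$. The minimum over an empty set is taken to be $+\infty$. Quantum notation: $\mathbb{X}_\Lambda:=\bigotimes_{i\in\Lambda}\mathbb{C}^2$, with orthonormal basis $|\sigma\rangle:=\bigotimes_{i\in\Lambda}|\sigma_i\rangle$, $\sigma\in\Omega_\Lambda$, where $|1\rangle=\binom{1}{0}$ and $|-1\rangle=\binom{0}{1}$. For the Pauli matrices $\hat\sigma^z=\begin{pmatrix}1&0\\0&-1\end{pmatrix}$ and $\hat\sigma^x=\begin{pmatrix}0&1\\1&0\end{pmatrix}$, $\hat\sigma^z_i$ and $\hat\sigma^x_i$ are the operators on $\mathbb{X}_\Lambda$ acting as $\hat\sigma^z$, respectively $\hat\sigma^x$, on the $i$-th tensor factor and as the identity on the other factors. A function $f:\Omega_\Lambda\to\mathbb{R}$ gives the observable $\mathcal{F}_f:=f((\hat\sigma^z_i)_{i\in\Lambda})$, i.e. $\mathcal{F}_f|\sigma\rangle=f(\sigma)|\sigma\rangle$. In the same way $\mathcal{H}_{\rm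 cl}$ is defined by $\mathcal{H}_{\rm cl}|\sigma\rangle=H(\sigma)|\sigma\rangle$. The Hamiltonian is $\mathcal{H}:=\mathcal{H}_{\rm cl}-\sum_{i\in\Lambda}\lambda_i\hat\sigma^x_i$. For observables $\mathcal{F},\mathcal{G}$, the quantum average is $\langle\mathcal{F}\rangle:=\operatorname{Tr}(\mathcal{F}e^{-\beta\mathcal{H}})/\operatorname{Tr}(e^{-\beta\mathcal{H}})$ and the truncated correlation is $\langle\mathcal{F};\mathcal{G}\rangle:=\langle\mathcal{F}\mathcal{G}\rangle-\langle\mathcal{F}\rangle\langle\mathcal{G}\rangle$. *)

(* Defs.v *)
From mathcomp Require Import all_boot all_order all_algebra finmap.
From mathcomp Require Import all_classical all_reals all_analysis.
From mathcomp Require Export complex.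

Set Implicit Arguments.
Unset Strict Implicit.
Unset Printing Implicit Defensive.

Import Order.TTheory GRing.Theory Num.Theory.
Import numFieldNormedType.Exports.

Local Open Scope classical_set_scope.
Local Open Scope ring_scope.
Local Open Scope complex_scope.

(* Spins are booleans: [true] is the spin 1 and [false] is the spin -1. *)
Notation config I := {ffun I -> bool}.

Section Classical.
Variables (R : realType) (I : finType).
Implicit Types (i : I) (s : config I) (f : config I -> R).

Definition flip i s : config I := [ffun j => if j == i then ~~ s j else s j].

Definition nabla i f s : R := f (flip i s) - f s.

Definition supnorm f : R := \big[Num.max/0]_(s : config I) `|f s|.

Definition trinorm f : R := \sum_i supnorm (nabla i f).

Definition Lambda_ f : {set I} := [set i | 0 < supnorm (nabla i f)].

End Classical.

Section Lattice.
Variables (R : realType) (d : nat).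

Definition l1dist (x y : 'rV[int]_d) : nat := (\sum_k `|x 0%R k - y 0%R k|)%N.

(* A minimum over an empty range is [+oo]. *)
Definition setdist (L : {fset 'rV[int]_d}) (A B : {set L}) : \bar R :=
  \big[Order.min/+oo%E]_(i in A) \big[Order.min/+oo%E]_(j in B)
    (l1dist (val i) (val j))%:R%:E.

End Lattice.

Definition expmx (K : numFieldType) n (A : 'M[K]_n) : 'M[K]_n :=
  limn (series (fun k : nat => (k`!%:R)^-1 *: A ^+ k)).

Section Quantum.
Variables (R : realType) (I : finType).
Implicit Types (i : I) (s : config I) (f : config I -> R).

(* The coordinates of the tensor product of the spaces C^2 over I are indexed
   by [config I], through [enum_rank]/[enum_val]; an operator is its matrix
   acting on column vectors. *)
Definition operator := 'M[R[i]]_#|config I|.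

Definition conf (a : 'I_#|config I|) : config I := enum_val a.

(* |1> is the first basis vector of C^2 and |-1> is the second one. *)
Definition spin_index (b : bool) : 'I_2 := if b then 0 else 1.

Definition ket1 (b : bool) : 'cV[R[i]]_2 := delta_mx (spin_index b) 0.

Definition ket s : 'cV[R[i]]_#|config I| :=
  \col_a \prod_j ket1 (s j) (spin_index (conf a j)) 0.

Definition tensor_op (A : I -> 'M[R[i]]_2) : operator :=
  \matrix_(a, b)
    \prod_j A j (spin_index (conf a j)) (spin_index (conf b j)).

Definition site_op (A : 'M[R[i]]_2) i : operator :=
  tensor_op (fun j => if j == i then A else 1%:M).

Definition pauli_x : 'M[R[i]]_2 := \matrix_(k, l) (k != l)%:R.

Definition sigma_x i : operator := site_op pauli_x i.

Definition observable f : operator :=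
  diag_mx (\row_a (f (conf a))%:C).

Definition hamiltonian (H : config I -> R) (h : I -> R) : operator :=
  observable H - \sum_i (h i)%:C *: sigma_x i.

Definition qaverage (beta : R) (Ham F : operator) : R[i] :=
  \tr (F *m expmx (- beta%:C *: Ham)) / \tr (expmx (- beta%:C *: Ham)).

Definition qtruncated (beta : R) (Ham F G : operator) : R[i] :=
  qaverage beta Ham (F *m G) - qaverage beta Ham F * qaverage beta Ham G.

Lemma spin_index_inj : injective spin_index. Proof. by case; case. Qed.

Lemma ketE s a : ket s a 0 = (conf a == s)%:R.
Proof.
rewrite mxE; have [->|ne] := eqVneq (conf a) s.
  by rewrite big1 // => j _; rewrite mxE !eqxx.
have [j nej] : exists j, conf a j != s j.
  apply/existsP; apply: contra_neqT ne; rewrite negb_exists => /forallP e.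
  by apply/ffunP => j; have /negPn/eqP := e j.
rewrite (bigD1 j) //= mxE (inj_eq spin_index_inj) (negbTE nej) mul0r //.
Qed.

Lemma observable_ket f s : observable f *m ket s = (f s)%:C *: ket s.
Proof.
apply/matrixP => a z; rewrite ord1 mul_diag_mx !mxE -[\prod__ _]/(_).
have := ketE s a; rewrite mxE => ->.
by case: eqP => [->|]; rewrite ?mulr0.
Qed.

Lemma sigma_x_ket i s : sigma_x i *m ket s = ket (flip i s).
Proof.
apply/matrixP => a z; rewrite ord1 mxE (bigD1 (enum_rank s)) //=.
rewrite big1 => [|b neb]; last first.
  rewrite ketE [_ == s](_ : _ = false) ?mulr0 //.
  by apply: contraNF neb => /eqP <-; rewrite /conf enum_valK.
rewrite !ketE /conf enum_rankK eqxx mulr1 addr0 mxE -/(conf a) /conf enum_rankK.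
have [->|ne] := eqVneq (enum_val a) (flip i s).
  rewrite big1 // => j _; rewrite ffunE.
  by case: (j == i); rewrite mxE ?eqxx //; case: (s j).
have [j nej] : exists j, enum_val a j != flip i s j.
  apply/existsP; apply: contra_neqT ne; rewrite negb_exists => /forallP e.
  by apply/ffunP => j; have /negPn/eqP := e j.
rewrite (bigD1 j) //=; move: nej; rewrite ffunE.
by case: (j == i); rewrite !mxE; case: (enum_val a j); case: (s j);
  rewrite //= mul0r.
Qed.

End Quantum.

(* Main.v *)
Require Import Defs.
From mathcomp Require Import all_boot all_order all_algebra finmap.
From mathcomp Require Import all_classical all_reals all_analysis.
From mathcomp Require Import zify ring lra.
Import Order.TTheory GRing.Theory Num.Theory.
Import numFieldNormedType.Exports.
Local Open Scope ring_scope.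

(** The estimate is a classical one in disguise. In the basis of spin
    configurations the off-diagonal entries of [- beta] times the Hamiltonian are
    nonnegative, so by the Trotter formula ([trotter]) its exponential is the
    limit of powers of a transfer matrix with nonnegative entries, and the quantum
    average of a function of the z-spins is the limit of its averages at time 0
    under a classical weight on families of closed trajectories in discrete
    imaginary time ([transfer_trace]).

    The trajectory of the spin at the site i, over the whole imaginary time, is
    regarded as a single variable. The transverse field acts on each site
    separately, hence only contributes to the a priori weight of one trajectory;
    the coupling of the sites is the time average of [beta * H]. Changing the
    trajectory at j alters the energy differences between trajectories at i by at
    most 2 beta C, and not at all when j is at distance more than R from i
    ([energy_mixed]). Therefore the conditional law of the trajectory at i moves
    by at most e^(2 beta C) - 1 in the l1 norm, whatever the number of time slices
    and the strength of the transverse field ([normalized_dist], [gibbs_cov]).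

    A site has at most 2 (2R)^d neighbours ([card_l1ball]), so the assumption
    [gamma > 0] puts the system in Dobrushin's uniqueness regime. Dobrushin's
    estimate for covariances ([dobrushin_cov]) holds with any weight on the sites
    for which the weighted influences on each site stay below a fraction
    alpha < 1 of the weight of that site. The exponential of delta times the
    distance to the support of f is such a weight, with alpha = 1/2, because
    delta R <= 1/20 ([decay]): this gives the truncated correlation a bound
    2 |||f||| |||g||| e^(- delta dist), and N >= 2. *)

Set Implicit Arguments.
Unset Strict Implicit.
Unset Printing Implicit Defensive.

(** * Dobrushin's covariance estimate *)

Definition upd (I : finType) (S : Type) (x : {ffun I -> S}) i s : {ffun I -> S} :=
  [ffun j => if j == i then s else x j].

Section Upd.
Variables (I : finType) (S : Type).
Implicit Types (x y : {ffun I -> S}) (i j : I) (s t : S).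

Lemma upd_same x i s : upd x i s i = s.
Proof. by rewrite ffunE eqxx. Qed.

Lemma upd_other x i s j : j != i -> upd x i s j = x j.
Proof. by rewrite ffunE => /negbTE ->. Qed.

Lemma upd_id x i : upd x i (x i) = x.
Proof. by apply/ffunP => j; rewrite ffunE; case: eqP => [->|]. Qed.

Lemma upd_upd x i s t : upd (upd x i s) i t = upd x i t.
Proof. by apply/ffunP => j; rewrite !ffunE; case: eqP. Qed.

Lemma updC x i j s t : i != j -> upd (upd x i s) j t = upd (upd x j t) i s.
Proof.
move=> ij; apply/ffunP => l; rewrite !ffunE.
by case: (eqVneq l j) => [->|//]; rewrite eq_sym (negbTE ij).
Qed.

End Upd.

(** The oscillations of a function are handled through vectors of upper bounds
    rather than through their exact values, so that the estimate on the
    oscillations of a resampled function is again such a vector. *)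
Definition osc_bound (R : realType) (I S : finType) (F : {ffun I -> S} -> R)
  (D : I -> R) := forall i x s, `|F (upd x i s) - F x| <= D i.

(** The covariance under the normalization of [p], multiplied by the square of
    the total mass: without division it passes to limits of [p] termwise. *)
Definition cov (R : realType) (X : finType) (p : X -> R) (F G : X -> R) : R :=
  (\sum_x p x) * (\sum_x p x * (F x * G x))
  - (\sum_x p x * F x) * (\sum_x p x * G x).

Section Covariance.
Variables (R : realType) (X : finType) (p : X -> R).
Implicit Types F G : X -> R.

Lemma covDl F1 F2 G : cov p (fun x => F1 x + F2 x) G = cov p F1 G + cov p F2 G.
Proof.
rewrite /cov.
under [in X in _ * X - _]eq_bigr do rewrite mulrDl mulrDr.
under [in X in _ - X * _]eq_bigr do rewrite mulrDr.
rewrite !big_split /=; ring.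
Qed.

Lemma covE F G :
  cov p F G = \sum_x \sum_y p x * p y * ((F x - F y) * G x).
Proof.
rewrite /cov mulrC 2!big_distrlr /= [X in _ - X]exchange_big -sumrB.
apply: eq_bigr => x _; rewrite -sumrB; apply: eq_bigr => y _; ring.
Qed.

Lemma cov_le (p_ge0 : forall x, 0 <= p x) F G a b :
  (forall x y, `|F x - F y| <= a) -> (forall x, `|G x| <= b) ->
  `|cov p F G| <= (\sum_x p x) ^+ 2 * (a * b).
Proof.
move=> Fa Gb; rewrite covE expr2 big_distrlr /= mulr_suml.
rewrite (le_trans (ler_norm_sum _ _ _)) //; apply: ler_sum => x _.
rewrite mulr_suml (le_trans (ler_norm_sum _ _ _)) //; apply: ler_sum => y _.
by rewrite normrM ger0_norm ?mulr_ge0 // ler_wpM2l ?mulr_ge0 // normrM ler_pM.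
Qed.

End Covariance.

Section Dobrushin.
Local Open Scope classical_set_scope.
Variables (R : realType) (I S : finType).
Local Notation X := {ffun I -> S}.
Implicit Types (x y : X) (i j : I) (s t : S) (F G : X -> R) (D : I -> R).

(** The coordinates of [y] are replaced by those of [x] one at a time. *)
Lemma osc_bound_dist F D x y :
  osc_bound F D -> `|F x - F y| <= \sum_i D i.
Proof.
move=> FD.
have D_ge0 i : 0 <= D i by apply: le_trans (FD i x (x i)); rewrite normr_ge0.
pose z (r : seq I) : X := [ffun i => if i \in r then x i else y i].
have zr r : `|F (z r) - F y| <= \sum_(i <- r) D i.
  elim: r => [|i r IH].
    rewrite big_nil (_ : z [::] = y) ?subrr ?normr0 //.
    by apply/ffunP => i; rewrite ffunE.
  rewrite big_cons (_ : z (i :: r) = upd (z r) i (x i)).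
    rewrite -(subrKA (F (z r))) (le_trans (ler_normD _ _)) // lerD //.
  by apply/ffunP => j; rewrite !ffunE inE; case: eqP => [->|].
have := zr (enum I); rewrite big_enum /= (_ : z _ = x) //.
by apply/ffunP => i; rewrite ffunE mem_enum.
Qed.

(* [k i x] is the conditional law, under [p], of the coordinate [i] given the
   other coordinates of [x]; it is reversible for [p]. *)
Variables (p : X -> R) (k : I -> X -> S -> R).
Hypothesis p_ge0 : forall x, 0 <= p x.
Hypothesis k_ge0 : forall i x s, 0 <= k i x s.
Hypothesis k_sum1 : forall i x, \sum_s k i x s = 1.
Hypothesis k_upd : forall i x s, k i (upd x i s) =1 k i x.
Hypothesis k_rev : forall i x s,
  p x * k i x s = p (upd x i s) * k i x (x i).

Definition resample i F x := \sum_s k i x s * F (upd x i s).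

(** Resampling the coordinate [i] does not change expectations against functions
    of the other coordinates: exchanging the old and the new value of the
    coordinate is an involution which, by reversibility, preserves the joint
    law of the two values. *)
Lemma resample_sum i F G : (forall x s, G (upd x i s) = G x) ->
  \sum_x p x * (resample i F x * G x) = \sum_x p x * (F x * G x).
Proof.
move=> Gi; pose h (u : X * S) : X * S := (upd u.1 i u.2, u.1 i).
have hK : involutive h.
  by case=> x s; rewrite /h /= upd_upd upd_id upd_same.
transitivity (\sum_(u : X * S) p u.1 * k i u.1 u.2 * (F (upd u.1 i u.2) * G u.1)).
  rewrite -(pair_bigA _ (fun x s => p x * k i x s * (F (upd x i s) * G x))).
  apply: eq_bigr => x _; rewrite mulr_suml mulr_sumr; apply: eq_bigr => s _.
  ring.
rewrite (reindex_inj (inv_inj hK)) /=.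
transitivity (\sum_(u : X * S) p u.1 * k i u.1 u.2 * (F u.1 * G u.1)).
  apply: eq_bigr => -[x s] _ /=.
  by rewrite upd_upd upd_id Gi k_upd -k_rev.
rewrite -(pair_bigA _ (fun x s => p x * k i x s * (F x * G x))) /=.
apply: eq_bigr => x _; rewrite -mulr_suml -mulr_sumr k_sum1 mulr1 //.
Qed.

Lemma resample_upd i F x s : resample i F (upd x i s) = resample i F x.
Proof. by apply: eq_bigr => t _; rewrite k_upd upd_upd. Qed.

Lemma resample_dist i F D x :
  osc_bound F D -> `|F x - resample i F x| <= D i.
Proof.
move=> FD; rewrite -[F x]mul1r -(k_sum1 i x) mulr_suml -sumrB.
rewrite (le_trans (ler_norm_sum _ _ _)) // -[leRHS]mul1r -(k_sum1 i x) mulr_suml.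
apply: ler_sum => s _; rewrite -mulrBr normrM ger0_norm // ler_wpM2l //.
by rewrite distrC.
Qed.

(** The fluctuation of [F] at the site [i] is orthogonal to every function of the
    other coordinates, hence to constants and to [resample i G]: only the
    fluctuation of [G] at the same site contributes. *)
Lemma cov_resample i F G D D' : osc_bound F D -> osc_bound G D' ->
  `|cov p (fun x => F x - resample i F x) G| <= (\sum_x p x) ^+ 2 * (D i * D' i).
Proof.
move=> FD GD.
have F0 G' : (forall x s, G' (upd x i s) = G' x) ->
    \sum_x p x * ((F x - resample i F x) * G' x) = 0.
  move=> G'i; under eq_bigr do rewrite mulrBl mulrBr.
  by rewrite sumrB resample_sum // subrr.
rewrite /cov [X in _ - X * _](_ : _ = 0) ?mul0r ?subr0; last first.
  by have := F0 (fun=> 1) (fun _ _ => erefl); under eq_bigr do rewrite mulr1.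
rewrite [X in _ * X](_ : _ = \sum_x p x *
    ((F x - resample i F x) * (G x - resample i G x))); last first.
  under [RHS]eq_bigr do rewrite mulrBr mulrBr.
  by rewrite sumrB [X in _ - X]F0 ?subr0 // => x s; rewrite resample_upd.
rewrite normrM expr2 -mulrA ger0_norm ?sumr_ge0 // ler_wpM2l ?sumr_ge0 //.
rewrite mulr_suml (le_trans (ler_norm_sum _ _ _)) //; apply: ler_sum => x _.
rewrite normrM ger0_norm // ler_wpM2l // normrM ler_pM //.
  exact: resample_dist.
exact: resample_dist.
Qed.

(* [c i j] bounds the influence of the coordinate [j] on the conditional law of
   the coordinate [i]. *)
Variable c : I -> I -> R.
Hypothesis k_c : forall i j x t, i != j ->
  \sum_s `|k i (upd x j t) s - k i x s| <= c i j.

(** Resampling at [i] erases the oscillation at [i] and hands a fraction [c i j]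
    of it to the other sites [j], through the change of the conditional law. *)
Lemma resample_osc i F D : osc_bound F D ->
  osc_bound (resample i F) (fun j => if j == i then 0 else D j + c i j * D i).
Proof.
move=> FD j x t; case: eqVneq => [->|ji].
  by rewrite resample_upd subrr normr0.
have D_ge0 : 0 <= D i by apply: le_trans (FD i x (x i)); rewrite normr_ge0.
(* The constant [F x] can be subtracted in the second sum because both
   conditional laws have mass 1. *)
have -> : resample i F (upd x j t) - resample i F x =
    \sum_s k i (upd x j t) s * (F (upd (upd x i s) j t) - F (upd x i s)) +
    \sum_s (k i (upd x j t) s - k i x s) * (F (upd x i s) - F x).
  rewrite /resample -sumrB -big_split /=.
  have -> : \sum_s (k i (upd x j t) s * F (upd (upd x j t) i s) -
      k i x s * F (upd x i s)) = \sum_s ((k i (upd x j t) s *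
      F (upd (upd x i s) j t) - k i x s * F (upd x i s)) -
      (k i (upd x j t) s - k i x s) * F x).
    have k0 : \sum_s (k i (upd x j t) s - k i x s) = 0.
      by rewrite sumrB !k_sum1 subrr.
    rewrite [RHS]sumrB -[X in _ = _ - X]mulr_suml k0 mul0r subr0.
    by apply: eq_bigr => s _; rewrite updC.
  by apply: eq_bigr => s _; ring.
rewrite (le_trans (ler_normD _ _)) // lerD //.
  rewrite (le_trans (ler_norm_sum _ _ _)) // -[leRHS]mul1r.
  rewrite -(k_sum1 i (upd x j t)) mulr_suml.
  by apply: ler_sum => s _; rewrite normrM ger0_norm // ler_wpM2l.
rewrite (le_trans (ler_norm_sum _ _ _)) //.
apply: le_trans (_ : _ <= (\sum_s `|k i (upd x j t) s - k i x s|) * D i) _.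
  by rewrite mulr_suml; apply: ler_sum => s _; rewrite normrM ler_wpM2l.
by rewrite ler_wpM2r // k_c // eq_sym.
Qed.

Variables (w : I -> R) (alpha : R).
Hypothesis w_gt0 : forall i, 0 < w i.
Hypothesis alpha_lt1 : alpha < 1.
Hypothesis w_c : forall i, \sum_(j | j != i) w j * c i j <= alpha * w i.

(** In the seminorm [\sum_i w i * D i], an average over [i] of the resamplings
    contracts by [rho = 1 - (1 - alpha) / #|I|], since the part of the
    oscillation erased at [i] is [w i * D i] and at most the fraction [alpha] of
    it comes back at the other sites. Writing each [F] as [resample i F] plus its
    fluctuation at [i], whose covariance with [G] is controlled by the
    oscillations at [i] alone, and averaging over [i], any a priori bound [B] on
    the ratio of the covariance to this seminorm improves to
    [rho * B] plus a constant. The fixed point of this iteration is the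
    announced bound; a weight [w] growing away from the support of [F] turns it
    into decay of correlations. *)
Theorem dobrushin_cov F G D D' (b : R) (x0 : X) :
  osc_bound F D -> osc_bound G D' -> (forall i, D' i <= b * w i) ->
  `|cov p F G| <= (\sum_x p x) ^+ 2 * (b / (1 - alpha)) * \sum_i w i * D i.
Proof.
move=> FD GD D'b; set Z2 := _ ^+ 2; set K := Z2 * _.
have Z2_ge0 : 0 <= Z2 by rewrite sqr_ge0.
have Z2E : Z2 = (\sum_x p x) ^+ 2 by [].
clearbody Z2.
have D_ge0 F' D0 : osc_bound F' D0 -> forall i, 0 <= D0 i.
  by move=> F'D i; apply: le_trans (F'D i x0 (x0 i)); rewrite normr_ge0.
have alpha1 : 0 < 1 - alpha by rewrite subr_gt0.
(* The iteration starts from the total oscillation of [F] times the supremum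
   of [G]. *)
have [B [B_ge0 HB]] : exists B, 0 <= B /\ forall F D, osc_bound F D ->
    `|cov p F G| <= B * \sum_i w i * D i.
  pose W := \sum_i (w i)^-1; pose g := \sum_x `|G x|.
  have W_ge0 : 0 <= W by apply: sumr_ge0 => i _; rewrite invr_ge0 ltW.
  have g_ge0 : 0 <= g by apply: sumr_ge0.
  exists (Z2 * (W * g)); split; first exact: mulr_ge0 Z2_ge0 (mulr_ge0 W_ge0 g_ge0).
  move=> F' D0 F'D; rewrite -[leRHS]mulrA -[_ * g * _]mulrA [g * _]mulrC [W * _]mulrA.
  rewrite Z2E; apply: cov_le => // [x y|x].
    apply: le_trans (osc_bound_dist x y F'D) _.
    rewrite mulr_suml; apply: ler_sum => i _.
    rewrite -[leLHS](mulKf (lt0r_neq0 (w_gt0 i))).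
    rewrite ler_wpM2l ?invr_ge0 ?(ltW (w_gt0 i)) // (bigD1 i) //= lerDl sumr_ge0 // => j _.
    by rewrite mulr_ge0 ?(D_ge0 _ _ F'D) ?(ltW (w_gt0 j)).
  by rewrite /g (bigD1 x) //= lerDl sumr_ge0.
case: (posnP #|I|) => [I0|I_gt0].
  have e0 (D0 : I -> R) : \sum_i w i * D0 i = 0.
    by rewrite big1 // => i _; have := fintype0 i I0.
  by have := HB _ _ FD; rewrite !e0 !mulr0.
have [n nE] : exists n : R, n = #|I|%:R by eexists.
pose rho := (n - (1 - alpha)) / n.
have n_ge1 : 1 <= n by rewrite nE ler1n.
have n_gt0 : 0 < n by apply: lt_le_trans n_ge1.
have alpha_ge0 : 0 <= alpha.
  have /card_gt0P [i _] := I_gt0.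
  rewrite -(pmulr_lge0 _ (w_gt0 i)) (le_trans _ (w_c i)) // sumr_ge0 // => j ji.
  rewrite mulr_ge0 ?(ltW (w_gt0 j)) ?(le_trans _ (k_c x0 (x0 i) _)) 1?eq_sym //.
  exact: sumr_ge0.
have b_ge0 : 0 <= b.
  have /card_gt0P [i _] := I_gt0.
  by rewrite -(pmulr_lge0 _ (w_gt0 i)) (le_trans _ (D'b i)) // (D_ge0 _ _ GD).
have rho_ge0 : 0 <= rho by rewrite divr_ge0; lra.
have rho_lt1 : rho < 1 by rewrite ltr_pdivrMr //; lra.
have K_ge0 : 0 <= K by exact: mulr_ge0 Z2_ge0 (divr_ge0 b_ge0 (ltW alpha1)).
have Kr_ge0 m : 0 <= K + rho ^+ m * B.
  exact: addr_ge0 K_ge0 (mulr_ge0 (exprn_ge0 m rho_ge0) B_ge0).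
have iter m : forall F D, osc_bound F D ->
    `|cov p F G| <= (K + rho ^+ m * B) * \sum_i w i * D i.
  elim: m => [|m IH] F' D0 F'D.
    rewrite expr0 mul1r (le_trans (HB _ _ F'D)) // ler_wpM2r //.
      by rewrite sumr_ge0 // => i _; rewrite mulr_ge0 ?(D_ge0 _ _ F'D) ?(ltW (w_gt0 i)).
    by rewrite lerDr.
  have [N NE] : exists N, N = \sum_i w i * D0 i by exists (\sum_i w i * D0 i).
  rewrite -NE.
  have step i : `|cov p F' G| <= (K + rho ^+ m * B) *
      (N - (1 - alpha) * (w i * D0 i)) + Z2 * b * (w i * D0 i).
    have -> : cov p F' G = cov p (resample i F') G +
        cov p (fun x => F' x - resample i F' x) G.
      by rewrite -covDl; congr cov; apply/funext => x; rewrite addrC subrK.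
    rewrite (le_trans (ler_normD _ _)) // lerD //.
      apply: le_trans (IH _ _ (resample_osc i F'D)) _.
      rewrite ler_wpM2l ?Kr_ge0 //.
      rewrite NE (bigD1 i) //= [X in _ <= X - _](bigD1 i) //= eqxx mulr0 add0r.
      rewrite (eq_bigr (fun j => w j * D0 j + (w j * c i j) * D0 i)); last first.
        by move=> j /negbTE ->; rewrite mulrDr mulrA.
      rewrite big_split /= -mulr_suml.
      have := ler_wpM2r (D_ge0 _ _ F'D i) (w_c i).
      set u := \sum_(_ | _) _; set v := \sum_(_ | _) _; lra.
    apply: le_trans (cov_resample i F'D GD) _.
    rewrite -Z2E -[leRHS]mulrA ler_wpM2l // [leLHS]mulrC [leRHS]mulrA.
    by rewrite ler_wpM2r ?(D_ge0 _ _ F'D).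
  have : \sum_(i : I) `|cov p F' G| <= \sum_(i : I) ((K + rho ^+ m * B) *
      (N - (1 - alpha) * (w i * D0 i)) + Z2 * b * (w i * D0 i)).
    by apply: ler_sum => i _; exact: step.
  have sumI (u : R) : \sum_(i : I) u = n * u by rewrite sumr_const nE mulr_natl.
  rewrite big_split /= -mulr_sumr sumrB -!mulr_sumr -NE !sumI.
  move=> h; rewrite -(ler_pM2l n_gt0); apply: le_trans h _.
  have -> : Z2 * b = (1 - alpha) * K by rewrite /K; field; lra.
  rewrite le_eqVlt; apply/orP; left; apply/eqP.
  rewrite exprS /rho; field; lra.
have cvg_bound : (fun m => (K + rho ^+ m * B) * \sum_i w i * D i) @ \oo -->
    (K + 0 * B) * \sum_i w i * D i.
  apply: cvgMl; apply: cvgD; first exact: cvg_cst.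
  by apply: cvgMl; apply: cvg_expr; rewrite ger0_norm.
rewrite mul0r addr0 in cvg_bound.
rewrite -(cvg_lim _ cvg_bound) //; apply: limr_ge.
  by apply/cvg_ex; eexists; exact: cvg_bound.
by near=> m; exact: iter.
Unshelve. all: by end_near.
Qed.

End Dobrushin.

(** * Gibbs measures over an arbitrary product a priori weight *)

Section Normalized.
Variables (R : realType) (S : finType).
Implicit Types q : S -> R.

(** Summing the hypothesis over [t] bounds the ratio of the two densities by [e];
    since it is invariant under the exchange of [q, s] with [q', t], so is the
    inverse ratio. Two densities
    whose ratio is between [e^-1] and [e] differ pointwise by at most [e - 1]
    times either of them. *)
Lemma normalized_dist q q' (e : R) :
  (forall s, 0 <= q s) -> (forall s, 0 <= q' s) ->
  0 < \sum_s q s -> 0 < \sum_s q' s ->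
  (forall s t, q' s * q t <= e * (q s * q' t)) ->
  \sum_s `|q' s / (\sum_t q' t) - q s / (\sum_t q t)| <= e - 1.
Proof.
move=> q0 q'0 Q_gt0 Q'_gt0 qe.
set Q := \sum_t q t in Q_gt0 *; set Q' := \sum_t q' t in Q'_gt0 *.
have up s : q' s / Q' <= e * (q s / Q).
  rewrite ler_pdivrMr // mulrA mulrAC ler_pdivlMr // /Q /Q' mulr_sumr.
  by rewrite mulr_sumr; apply: ler_sum => t _; rewrite -mulrA.
have lo s : q s / Q <= e * (q' s / Q').
  rewrite ler_pdivrMr // mulrA mulrAC ler_pdivlMr // /Q /Q' mulr_sumr.
  rewrite mulr_sumr; apply: ler_sum => t _.
  by rewrite mulrC -mulrA (le_trans (qe t s)) // [q t * _]mulrC.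
have e_ge1 : 1 <= e.
  have : \sum_s q' s / Q' <= \sum_s e * (q s / Q) by exact: ler_sum.
  by rewrite -mulr_sumr -!mulr_suml -/Q -/Q' !divff ?gt_eqF // mulr1.
have Q1 : \sum_s q s / Q = 1 by rewrite -mulr_suml divff // gt_eqF.
rewrite -[leRHS]mulr1 -[X in _ * X]Q1 mulr_sumr.
apply: ler_sum => s _; move: (up s) (lo s).
have : 0 <= q s / Q by rewrite divr_ge0 // ltW.
set u := q s / Q; set v := q' s / Q' => u0 uv vu.
case: (ltP v u) => [vltu|uv'].
  have h : 0 <= (e - 1) * (u - v) by rewrite mulr_ge0 // subr_ge0 // ltW.
  rewrite distrC gtr0_norm ?subr_gt0 //; lra.
rewrite ger0_norm ?subr_ge0 //; lra.
Qed.

End Normalized.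

Section Gibbs.
Variables (R : realType) (I S : finType).
Local Notation X := {ffun I -> S}.
Implicit Types (x y : X) (i j : I) (s t : S).
Variables (a : I -> S -> R) (E : X -> R).
Hypothesis a_ge0 : forall i s, 0 <= a i s.
Hypothesis a_sum : forall i, 0 < \sum_s a i s.

Definition gibbs x : R := \prod_i a i (x i) * expR (- E x).

Let q i x s := a i s * expR (- E (upd x i s)).

(** The conditional law of one coordinate. Defining it by this quotient makes
    sense even for configurations of zero weight, as the factors of [gibbs] at
    the other sites have been cancelled. *)
Definition glauber i x s : R := q i x s / \sum_t q i x t.

Let q_ge0 i x s : 0 <= q i x s.
Proof. by rewrite mulr_ge0 ?expR_ge0. Qed.

Let q_sum i x : 0 < \sum_s q i x s.
Proof.
rewrite lt0r sumr_ge0 // andbT psumr_neq0 //.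
have := a_sum i; rewrite lt0r psumr_neq0 // => /andP[/hasP[s _ sa] _].
by apply/hasP; exists s; rewrite ?mem_index_enum //= mulr_gt0 ?expR_gt0.
Qed.

(** The influence of [j] on [i] only depends on the mixed differences of the
    energy in the coordinates [i] and [j]: the a priori weights [a] cancel,
    whatever their values. *)
Theorem gibbs_cov (e : I -> I -> R) (w : I -> R) (alpha b : R)
    (F G : X -> R) (D D' : I -> R) (x0 : X) :
  (forall i j x t s s', i != j ->
     (E (upd (upd x j t) i s') - E (upd (upd x j t) i s)) -
     (E (upd x i s') - E (upd x i s)) <= e i j) ->
  (forall i, 0 < w i) -> alpha < 1 ->
  (forall i, \sum_(j | j != i) w j * (expR (e i j) - 1) <= alpha * w i) ->
  osc_bound F D -> osc_bound G D' -> (forall i, D' i <= b * w i) ->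
  `|cov gibbs F G| <=
    (\sum_x gibbs x) ^+ 2 * (b / (1 - alpha)) * \sum_i w i * D i.
Proof.
move=> Ee w_gt0 alpha_lt1 w_e FD GD D'b.
apply: (@dobrushin_cov _ _ _ gibbs glauber _ _ _ _ _
  (fun i j => expR (e i j) - 1) _ w alpha) GD D'b => //.
- by move=> x; rewrite mulr_ge0 ?expR_ge0 ?prodr_ge0.
- by move=> i x s; rewrite divr_ge0 // ltW.
- by move=> i x; rewrite -mulr_suml divff // gt_eqF.
- move=> i x s t; rewrite /glauber /q upd_upd; congr (_ / _).
  by apply: eq_bigr => u _; rewrite upd_upd.
- move=> i x s; rewrite /glauber; set Q := \sum_t _.
  rewrite /q upd_id /gibbs (bigD1 i) //= [in RHS](bigD1 i) //= upd_same.
  rewrite [in RHS](eq_bigr (fun j => a j (x j))); last first.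
    by move=> j ji; rewrite upd_other.
  ring.
- move=> i j x t ij; apply: normalized_dist => // s s'.
  rewrite /q [leLHS](_ : _ = a i s * a i s' *
    expR (- E (upd (upd x j t) i s) - E (upd x i s'))); last first.
    by rewrite expRD; ring.
  rewrite [leRHS](_ : _ = a i s * a i s' * expR (e i j +
    (- E (upd x i s) - E (upd (upd x j t) i s')))); last first.
    by rewrite !expRD; ring.
  rewrite ler_wpM2l ?mulr_ge0 // ler_expR; have := Ee i j x t s s' ij; lra.
Qed.

End Gibbs.


(** * Expansion of matrix powers over paths *)

Section Paths.
Variables (R : realType).

Lemma sum_ffun_ordS (T : finType) n (h : T -> {ffun 'I_n -> T} -> R) :
  \sum_(x : {ffun 'I_n.+1 -> T}) h (x ord0) [ffun k => x (lift ord0 k)] =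
  \sum_a \sum_(y : {ffun 'I_n -> T}) h a y.
Proof.
rewrite pair_bigA /=.
pose g (u : T * {ffun 'I_n -> T}) : {ffun 'I_n.+1 -> T} :=
  [ffun k => oapp u.2 u.1 (unlift ord0 k)].
pose g' (x : {ffun 'I_n.+1 -> T}) := (x ord0, [ffun k => x (lift ord0 k)]).
rewrite [RHS](reindex g') //; exists g => [x _|[a y] _].
  apply/ffunP => k; rewrite ffunE /=.
  by case: unliftP => [l|] -> //=; rewrite ffunE.
rewrite /g /g' /=; congr pair; first by rewrite ffunE unlift_none.
by apply/ffunP => k; rewrite !ffunE liftK.
Qed.

Lemma path_sum m n (M : 'M[R]_m) (G K : 'I_m -> R) :
  \sum_(x : {ffun 'I_n.+1 -> 'I_m})
    G (x ord0) * (\prod_(k < n) M (x (widen_ord (leqnSn n) k)) (x (lift ord0 k)))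
    * K (x ord_max) =
  \sum_a \sum_b G a * (M ^+ n) a b * K b.
Proof.
elim: n G => [|n IH] G.
  transitivity (\sum_(x : {ffun 'I_1 -> 'I_m}) G (x ord0) * K (x ord0)).
    apply: eq_bigr => x _; rewrite big_ord0 mulr1; congr (_ * K (x _)).
    exact: val_inj.
  rewrite (sum_ffun_ordS (fun a (y : {ffun 'I_0 -> 'I_m}) => G a * K a)).
  apply: eq_bigr => a _; rewrite sumr_const card_ffun !card_ord mulr1n.
  rewrite (bigD1 a) //= big1 => [|b ba]; rewrite expr0 mxE ?eqxx ?addr0 ?mulr1 //.
  by rewrite eq_sym (negbTE ba) mulr0 mul0r.
pose h a (y : {ffun 'I_n.+1 -> 'I_m}) := G a * M a (y ord0) *
  (\prod_(k < n) M (y (widen_ord (leqnSn n) k)) (y (lift ord0 k))) * K (y ord_max).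
transitivity (\sum_(x : {ffun 'I_n.+2 -> 'I_m})
    h (x ord0) [ffun k => x (lift ord0 k)]).
  apply: eq_bigr => x _; rewrite /h big_ord_recl !ffunE !mulrA.
  congr (_ * M (x _) _ * _ * K (x _)); [exact: val_inj| |exact: val_inj].
  apply: eq_bigr => k _; rewrite !ffunE; congr (M (x _) _); exact: val_inj.
rewrite sum_ffun_ordS exchange_big /=.
transitivity (\sum_(y : {ffun 'I_n.+1 -> 'I_m}) (\sum_a G a * M a (y ord0)) *
  (\prod_(k < n) M (y (widen_ord (leqnSn n) k)) (y (lift ord0 k))) * K (y ord_max)).
  by apply: eq_bigr => y _; rewrite !mulr_suml.
rewrite (IH (fun b => \sum_a G a * M a b)) exchange_big [RHS]exchange_big /=.
apply: eq_bigr => b _; rewrite -!mulr_suml; congr (_ * _).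
transitivity (\sum_c \sum_a G a * M a c * (M ^+ n) c b).
  by apply: eq_bigr => c _; rewrite mulr_suml.
rewrite exchange_big; apply: eq_bigr => a _.
by rewrite exprS mxE mulr_sumr; apply: eq_bigr => c _; rewrite mulrA.
Qed.

Lemma trace_path_sum m n (M : 'M[R]_m) (G : 'I_m -> R) :
  \sum_(x : {ffun 'I_n.+1 -> 'I_m}) G (x ord0) *
    ((\prod_(k < n) M (x (widen_ord (leqnSn n) k)) (x (lift ord0 k)))
     * M (x ord_max) (x ord0)) =
  \sum_a G a * (M ^+ n.+1) a a.
Proof.
transitivity (\sum_(x : {ffun 'I_n.+1 -> 'I_m}) \sum_a (a == x ord0)%:R * G a *
    (\prod_(k < n) M (x (widen_ord (leqnSn n) k)) (x (lift ord0 k))) *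
     M (x ord_max) a).
  apply: eq_bigr => x _; rewrite (bigD1 (x ord0)) //= eqxx mul1r [X in _ + X]big1 ?addr0 ?mulrA //.
  by move=> a /negbTE ->; rewrite !mul0r.
rewrite exchange_big; apply: eq_bigr => a _ /=.
rewrite (path_sum n M (fun b => (a == b)%:R * G a) (fun b => M b a)).
rewrite (bigD1 a) //= [X in _ + X]big1 => [|b ba]; last first.
  by rewrite big1 // => c _; rewrite eq_sym (negbTE ba) !mul0r.
rewrite addr0 eqxx mul1r exprSr mxE mulr_sumr.
by apply: eq_bigr => c _; rewrite mulrA.
Qed.

End Paths.

(** * Trajectories in discrete imaginary time *)

Section SpinFlip.
Variables (R : realType) (I : finType).
Implicit Types (H : config I -> R) (i j : I) (s : config I) (u v : bool).

Lemma le_supnorm H s : `|H s| <= supnorm H.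
Proof. by rewrite /supnorm (bigD1 s) //= le_max lexx. Qed.

Lemma supnorm_ge0 H : 0 <= supnorm H.
Proof. by rewrite /supnorm; elim/big_rec: _ => // s x _ x0; rewrite le_max x0 orbT. Qed.

Lemma flip_upd i s v : flip i (upd s i v) = upd s i (~~ v).
Proof. by apply/ffunP => j; rewrite !ffunE; case: eqP. Qed.

Lemma upd_diff H i s u v : H (upd s i u) - H (upd s i v) =
  if u == v then 0 else nabla i H (upd s i v).
Proof.
case: eqP => [->|uv]; first by rewrite subrr.
by rewrite /nabla flip_upd; congr (H (upd _ _ _) - _); case: u v uv => [] [].
Qed.

Lemma upd_diff_le H i s u v : `|H (upd s i u) - H (upd s i v)| <= supnorm (nabla i H).
Proof.
by rewrite upd_diff; case: eqP => _; rewrite ?normr0 ?supnorm_ge0 ?le_supnorm.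
Qed.

Lemma osc_bound_supnorm H : osc_bound H (fun i => supnorm (nabla i H)).
Proof. by move=> i s u; rewrite -{2}(upd_id s i) upd_diff_le. Qed.

End SpinFlip.

Section SpaceTime.
Variables (R : realType) (I : finType) (n : nat).
Variables (H : config I -> R) (tau : R) (eps : I -> R).
Local Notation S := {ffun 'I_n.+1 -> bool}.
Local Notation X := {ffun I -> S}.
Implicit Types (x : X) (i j : I) (k : 'I_n.+1) (u v : bool).

(** The matrix of [1 + eps i * sigma_x] at one site: an approximation of the
    exponential of [eps i * sigma_x] to first order. *)
Definition hop i u v : R := if u == v then 1 else eps i.

Definition transfer : 'M[R]_#|config I| := \matrix_(a, b)
  (expR (- (tau * H (conf a))) * \prod_i hop i (conf a i) (conf b i)).

Definition slice x k : config I := [ffun i => x i k].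

(** A configuration [x] assigns to each site a closed trajectory of [n.+1] spins.
    The transverse field acts on each site separately, so it only enters this
    a priori weight of a single trajectory. *)
Definition prior i (s : S) : R :=
  (\prod_(k < n) hop i (s (widen_ord (leqnSn n) k)) (s (lift ord0 k)))
  * hop i (s ord_max) (s ord0).

Definition energy x : R := tau * \sum_k H (slice x k).

(** The trace of a power of the transfer matrix sums over sequences of
    configurations of the spins; exchanging the roles of space and time, such a
    sequence is a configuration of trajectories. *)
Lemma transfer_trace (f : config I -> R) :
  \sum_a (transfer ^+ n.+1) a a * f (conf a) =
  \sum_x gibbs prior energy x * f (slice x ord0).
Proof.
under eq_bigr do rewrite mulrC.
rewrite -(trace_path_sum n transfer (fun a => f (conf a))).
pose g x : {ffun 'I_n.+1 -> 'I_#|config I|} := [ffun k => enum_rank (slice x k)].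
pose g' (y : {ffun 'I_n.+1 -> 'I_#|config I|}) : X :=
  [ffun i => [ffun k => conf (y k) i]].
rewrite (reindex g) /=; last first.
  exists g' => [x _|y _].
    by apply/ffunP => i; apply/ffunP => k; rewrite !ffunE /conf enum_rankK ffunE.
  apply/ffunP => k; rewrite !ffunE; apply: (canLR (@enum_valK _)).
  by apply/ffunP => i; rewrite !ffunE.
apply: eq_bigr => x _; rewrite mulrC.
have gx k : conf (g x k) = slice x k by rewrite /conf ffunE enum_rankK.
rewrite gx; congr (_ * _).
pose h k l := \prod_i hop i (slice x k i) (slice x l i).
pose e k := expR (- (tau * H (slice x k))).
have -> : gibbs prior energy x =
    (\prod_(k < n) h (widen_ord (leqnSn n) k) (lift ord0 k)) * h ord_max ord0 *
    ((\prod_(k < n) e (widen_ord (leqnSn n) k)) * e ord_max).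
  rewrite /gibbs /energy mulr_sumr -sumrN expR_sum big_ord_recr; congr (_ * _).
  rewrite /prior big_split /= exchange_big; congr (_ * _).
    by apply: eq_bigr => k _; apply: eq_bigr => i _; rewrite !ffunE.
  by apply: eq_bigr => i _; rewrite !ffunE.
have tE k l : transfer (g x k) (g x l) = e k * h k l by rewrite mxE !gx.
rewrite tE; under eq_bigr do rewrite tE.
by rewrite big_split /=; ring.
Qed.

Hypothesis tau_ge0 : 0 <= tau.
Hypothesis eps_ge0 : forall i, 0 <= eps i.
Variables (C : R) (near : rel I).
Hypothesis H_C : forall i, supnorm (nabla i H) <= C.
Hypothesis H_near : forall i j s u v t, i != j -> ~~ near i j ->
  H (upd (upd s j t) i u) - H (upd (upd s j t) i v) =
  H (upd s i u) - H (upd s i v).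

Lemma slice_upd x i (s : S) k : slice (upd x i s) k = upd (slice x k) i (s k).
Proof. by apply/ffunP => j; rewrite !ffunE; case: eqP. Qed.

(** Each time slice contributes at most [2 * tau * C], so with [tau] inversely
    proportional to the number [n.+1] of slices the influence of one trajectory
    on another one is bounded uniformly in the discretization. *)
Lemma energy_mixed i j x (t s s' : S) : i != j ->
  (energy (upd (upd x j t) i s') - energy (upd (upd x j t) i s)) -
  (energy (upd x i s') - energy (upd x i s)) <=
  if near i j then 2 * (tau * n.+1%:R) * C else 0.
Proof.
move=> ij; rewrite /energy -!mulrBr -!sumrB.
case: ifPn => nij.
  have -> : 2 * (tau * n.+1%:R) * C = tau * \sum_(k < n.+1) (2 * C).
    by rewrite sumr_const card_ord -mulr_natr; ring.
  rewrite ler_wpM2l // ler_sum // => k _; rewrite !slice_upd.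
  have bd z u v : `|H (upd z i u) - H (upd z i v)| <= C.
    exact: le_trans (upd_diff_le _ _ _ _ _) (H_C i).
  have := bd (slice x k) (s' k) (s k).
  have := bd (upd (slice x k) j (t k)) (s' k) (s k).
  rewrite !ler_norml; lra.
rewrite big1 ?mulr0 // => k _.
by rewrite !slice_upd H_near // subrr.
Qed.

Lemma hop_ge0 i u v : 0 <= hop i u v.
Proof. by rewrite /hop; case: eqP. Qed.

Lemma prior_ge0 i s : 0 <= prior i s.
Proof. by rewrite mulr_ge0 ?hop_ge0 ?prodr_ge0 // => k _; exact: hop_ge0. Qed.

Lemma prior_sum i : 0 < \sum_s prior i s.
Proof.
rewrite (bigD1 [ffun=> true]) //= ltr_wpDr //.
  by rewrite sumr_ge0 // => s _; exact: prior_ge0.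
rewrite /prior big1 => [|k _]; first by rewrite /hop !ffunE eqxx mulr1.
by rewrite /hop !ffunE eqxx.
Qed.

(** Dobrushin's estimate with whole trajectories as spins. As [tau * n.+1] is the
    inverse temperature, the condition on the weights is the same for all
    discretizations. *)
Theorem transfer_cov (w : I -> R) (alpha b : R) (f g : config I -> R)
    (D D' : I -> R) :
  (forall i, 0 < w i) -> alpha < 1 ->
  (forall i, \sum_(j | (j != i) && near i j)
     w j * (expR (2 * (tau * n.+1%:R) * C) - 1) <= alpha * w i) ->
  osc_bound f D -> osc_bound g D' -> (forall i, D' i <= b * w i) ->
  `|cov (fun a => (transfer ^+ n.+1) a a) (f \o conf (I := I)) (g \o conf (I := I))| <=
    (\sum_a (transfer ^+ n.+1) a a) ^+ 2 * (b / (1 - alpha)) * \sum_i w i * D i.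
Proof.
move=> w_gt0 alpha_lt1 w_near fD gD D'b.
have sl_osc (h : config I -> R) D0 : osc_bound h D0 ->
    osc_bound (fun x => h (slice x ord0)) D0.
  by move=> hD i x s; rewrite slice_upd.
have tr1 : \sum_a (transfer ^+ n.+1) a a = \sum_x gibbs prior energy x.
  have := transfer_trace (fun=> 1).
  by under eq_bigr do rewrite mulr1; under [in RHS]eq_bigr do rewrite mulr1.
have -> : cov (fun a => (transfer ^+ n.+1) a a) (f \o conf (I := I))
    (g \o conf (I := I)) = cov (gibbs prior energy)
    (fun x => f (slice x ord0)) (fun x => g (slice x ord0)).
  by rewrite /cov tr1 (transfer_trace (fun s => f s * g s)) !transfer_trace.
rewrite tr1.
apply: (gibbs_cov prior_ge0 prior_sum [ffun=> [ffun=> true]]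
  (e := fun i j => if near i j then 2 * (tau * n.+1%:R) * C else 0)
  _ w_gt0 alpha_lt1 _ (sl_osc _ _ fD) (sl_osc _ _ gD) D'b).
  move=> *; exact: energy_mixed.
move=> i; rewrite (le_trans _ (w_near i)) // (bigID (near i)) /=.
rewrite [X in _ + X]big1 => [|j /andP[_ /negbTE ->]].
  by rewrite addr0 ler_sum // => j /andP[_ ->].
by rewrite expR0 subrr mulr0.
Qed.

End SpaceTime.

(** * Convergence of (1 + B_n / n)^n to the matrix exponential *)

Section Limits.
Local Open Scope classical_set_scope.
Variable R : realType.

Lemma cvg_sumr (I : Type) (r : seq I) (P : pred I) (u : I -> nat -> R) (l : I -> R) :
  (forall i, P i -> u i n @[n --> \oo] --> l i) ->
  \sum_(i <- r | P i) u i n @[n --> \oo] --> \sum_(i <- r | P i) l i.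
Proof.
move=> ul; elim: r => [|i r IH].
  by rewrite big_nil; under eq_fun do rewrite big_nil; exact: cvg_cst.
rewrite big_cons; under eq_fun do rewrite big_cons.
by case: ifPn => // Pi; apply: cvgD => //; exact: ul.
Qed.

Lemma cvg_prodr (I : Type) (r : seq I) (u : I -> nat -> R) (l : I -> R) :
  (forall i, u i n @[n --> \oo] --> l i) ->
  \prod_(i <- r) u i n @[n --> \oo] --> \prod_(i <- r) l i.
Proof.
move=> ul; elim: r => [|i r IH].
  by rewrite big_nil; under eq_fun do rewrite big_nil; exact: cvg_cst.
by rewrite big_cons; under eq_fun do rewrite big_cons; exact: cvgM.
Qed.

(** Tannery's theorem, that is dominated convergence for series; the upper limits
    [N n] of the sums may vary as long as they exceed [n]. *)
Lemma tannery (t : nat -> nat -> R) (l M : nat -> R) (N : nat -> nat) :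
  (forall n k, `|t n k| <= M k) -> cvgn (series M) ->
  (forall k, t n k @[n --> \oo] --> l k) -> (forall n, (n <= N n)%N) ->
  series (t n) (N n) @[n --> \oo] --> limn (series l).
Proof.
move=> tM cM tl nN.
have lM k : `|l k| <= M k.
  rewrite -(cvg_lim _ (cvg_norm (tl k))) //; apply: limr_le.
    by apply/cvg_ex; eexists; exact: cvg_norm (tl k).
  by near=> n; exact: tM.
have M_ge0 k : 0 <= M k by apply: le_trans (lM k).
have ndM : nondecreasing_seq (series M) by exact: nondecreasing_series.
have tail (h : nat -> R) K m : (forall k, `|h k| <= M k) -> (K <= m)%N ->
    `|series h m - series h K| <= limn (series M) - series M K.
  move=> hM Km; apply: le_trans (_ : _ <= series M m - series M K) _.
    rewrite !sub_series_geq // (le_trans (ler_norm_sum _ _ _)) //.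
    exact: ler_sum.
  by rewrite lerD2r nondecreasing_cvgn_le.
have cl : cvgn (series l).
  apply: normed_cvg; apply: series_le_cvg cM => // k; exact: normr_ge0.
apply/cvgrPdist_le => e e_gt0.
have e3 : 0 < e / 3 by rewrite divr_gt0.
have [K _ HK] : \forall n \near \oo, limn (series M) - series M n <= e / 3.
  move/cvgrPdist_le : cM => /(_ _ e3); apply: filterS => n.
  by apply: le_trans; exact: ler_norm.
have {}HK : limn (series M) - series M K <= e / 3 by apply: HK => /=.
have tailE (h : nat -> R) : (forall k, `|h k| <= M k) ->
    forall m, (K <= m)%N -> `|series h m - series h K| <= e / 3.
  by move=> hM m Km; apply: le_trans HK; exact: tail.
have tail_l : `|limn (series l) - series l K| <= e / 3.
  have c : `|series l m - series l K| @[m --> \oo] -->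
      `|limn (series l) - series l K|.
    by apply: cvg_norm; apply: cvgB => //; exact: cvg_cst.
  rewrite -(cvg_lim _ c) //; apply: limr_le; first by apply/cvg_ex; eexists; exact: c.
  by near=> m; apply: tailE => //; near: m; exact: nbhs_infty_ge.
have head : series (t n) K @[n --> \oo] --> series l K.
  by apply: cvg_sumr => k _; exact: tl.
near=> n.
have nK : (K <= N n)%N.
  by apply: leq_trans (nN n); near: n; exact: nbhs_infty_ge.
have h1 : `|series l K - series (t n) K| <= e / 3.
  by near: n; move/cvgrPdist_le : head => /(_ _ e3).
have h2 : `|series (t n) (N n) - series (t n) K| <= e / 3.
  exact: tailE nK.
have := tail_l; move: h1 h2; rewrite !ler_norml; lra.
Unshelve. all: by end_near. Qed.

Lemma cvg_invS : (n.+1%:R^-1 : R) @[n --> \oo] --> (0 : R).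
Proof. exact: cvg_harmonic. Qed.

Lemma bin_div_le k n : 'C(n.+1, k)%:R / n.+1%:R ^+ k <= (k`!%:R)^-1 :> R.
Proof.
rewrite ler_pdivrMr ?exprn_gt0 // mulrC ler_pdivlMr ?ltr0n ?fact_gt0 //.
rewrite -natrM -natrX ler_nat bin_ffact.
elim: k => [//|k IH]; rewrite ffactnSr expnSr leq_mul //.
exact: leq_subr.
Qed.

Lemma cvg_bin_div k :
  ('C(n.+1, k)%:R / n.+1%:R ^+ k : R) @[n --> \oo] --> (k`!%:R^-1 : R).
Proof.
suff c : ((n.+1 ^_ k)%:R / n.+1%:R ^+ k : R) @[n --> \oo] --> (1 : R).
  have -> : (fun n => 'C(n.+1, k)%:R / n.+1%:R ^+ k : R) =
      (fun n => (k`!%:R)^-1 * ((n.+1 ^_ k)%:R / n.+1%:R ^+ k)).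
    apply/funext => n; rewrite -bin_ffact natrM.
    have : (k`!%:R : R) != 0 by rewrite pnatr_eq0 -lt0n fact_gt0.
    have : (n.+1%:R ^+ k : R) != 0 by rewrite expf_neq0 ?pnatr_eq0.
    by move=> h1 h2; field; rewrite h1 h2.
  by rewrite -[X in _ --> X]mulr1; apply: cvgMr.
elim: k => [|k IH].
  have -> : (fun n => (n.+1 ^_ 0)%:R / n.+1%:R ^+ 0 : R) = (fun=> 1).
    by apply/funext => n; rewrite expr0 divr1.
  exact: cvg_cst.
have -> : (fun n => (n.+1 ^_ k.+1)%:R / n.+1%:R ^+ k.+1 : R) =
    (fun n => (n.+1 ^_ k)%:R / n.+1%:R ^+ k * ((n.+1 - k)%:R / n.+1%:R)).
  apply/funext => n; rewrite ffactnSr natrM exprSr mulf_div //.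
rewrite -[X in _ --> X]mulr1; apply: cvgM => //.
have : (1 - k%:R * n.+1%:R^-1 : R) @[n --> \oo] --> (1 - k%:R * 0 : R).
  by apply: cvgB; [exact: cvg_cst|apply: cvgMr; exact: cvg_invS].
rewrite mulr0 subr0; apply: cvg_trans; apply: near_eq_cvg; near=> n.
rewrite natrB; last by near: n; exists k => //= n /= ?; exact: leqW.
by rewrite mulrBl divff // pnatr_eq0.
Unshelve. all: by end_near. Qed.

Section MatrixExp.
Variable m : nat.
Implicit Types A : 'M[R]_m.

(** Boundedness of the entries is all that is asked of a matrix, so that no matrix
    norm is needed: each product costs a factor [m]. *)
Lemma mx_pow_bound A b k : 0 <= b -> (forall i j, `|A i j| <= b) ->
  forall i j, `|(A ^+ k) i j| <= (m%:R * b) ^+ k.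
Proof.
move=> b_ge0 Ab; elim: k => [|k IH] i j.
  by rewrite !expr0 mxE; case: eqP => _; rewrite ?normr1 ?normr0.
rewrite exprS mxE (le_trans (ler_norm_sum _ _ _)) //.
apply: le_trans (_ : _ <= \sum_(l < m) b * (m%:R * b) ^+ k) _.
  by apply: ler_sum => l _; rewrite normrM ler_pM.
by rewrite sumr_const card_ord exprS -[leLHS]mulr_natl mulrA.
Qed.

Lemma mx_scaleX (c : R) A k : (c *: A) ^+ k = c ^+ k *: A ^+ k.
Proof.
elim: k => [|k IH]; first by rewrite !expr0 scale1r.
by rewrite !exprS IH -[LHS]scalemxAl -[X in _ *: X]scalemxAr scalerA.
Qed.

Lemma cvg_mx_pow (B : nat -> 'M[R]_m) A k :
  (forall i j, B n i j @[n --> \oo] --> A i j) ->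
  forall i j, (B n ^+ k) i j @[n --> \oo] --> (A ^+ k) i j.
Proof.
move=> BA; elim: k => [|k IH] i j; first by rewrite expr0; exact: cvg_cst.
under eq_fun do rewrite exprS mxE; rewrite exprS mxE.
by apply: cvg_sumr => l _; exact: cvgM.
Qed.

Definition exp_term A i j k : R := k`!%:R^-1 * (A ^+ k) i j.

Lemma cvg_exp_majorant (b : R) : cvgn (series (fun k => k`!%:R^-1 * b ^+ k)).
Proof.
by have := is_cvg_series_exp_coeff b; rewrite exp_coeffE.
Qed.

Lemma cvg_exp_term A i j : cvgn (series (exp_term A i j)).
Proof.
pose b : R := \sum_(u : 'I_m * 'I_m) `|A u.1 u.2|.
have b_ge0 : 0 <= b by exact: sumr_ge0.
have Ab k l : `|A k l| <= b.
  by rewrite /b (bigD1 (k, l)) //= lerDl sumr_ge0.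
apply: normed_cvg; apply: (series_le_cvg _ _ _ (@cvg_exp_majorant (m%:R * b))) => k /=.
  exact: normr_ge0.
  by rewrite mulr_ge0 ?invr_ge0 ?exprn_ge0 ?mulr_ge0.
by rewrite /exp_term normrM ger0_norm ?invr_ge0 // ler_wpM2l ?invr_ge0 ?mx_pow_bound.
Qed.

(** The binomial expansion has general term [B n ^+ k] times
    ['C(n.+1, k) / n.+1 ^ k], which is at most [1 / k!] and tends to it: Tannery's
    theorem applies with the exponential series of [m * b] as majorant. *)
Theorem cvg_mx_euler (B : nat -> 'M[R]_m) A :
  (forall i j, B n i j @[n --> \oo] --> A i j) ->
  forall i j, ((n.+1%:R^-1 *: B n + 1) ^+ n.+1) i j @[n --> \oo] -->
    limn (series (exp_term A i j)).
Proof.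
move=> BA i j.
have [b b_ge0 Bb] : exists2 b, 0 <= b & forall n k l, `|B n k l| <= b.
  have /(_ _ _) HB : forall k l, exists b, forall n, `|B n k l| <= b.
    move=> k l.
    have : cvgn (fun n => B n k l) by apply/cvg_ex; eexists; exact: BA.
    move/cvg_seq_bounded => -[b [_ /(_ (b + 1))]].
    rewrite ltrDl ltr01 => /(_ isT) h; exists (b + 1) => n.
    exact: h.
  have [b Hb] := choice (fun kl : 'I_m * 'I_m => HB kl.1 kl.2).
  exists (\sum_kl `|b kl|) => [|n k l]; first exact: sumr_ge0.
  rewrite (le_trans (Hb (k, l) n)) // (le_trans (ler_norm _)) //.
  by rewrite (bigD1 (k, l)) //= lerDl sumr_ge0.
pose t n k := 'C(n.+1, k)%:R / n.+1%:R ^+ k * (B n ^+ k) i j.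
have -> : (fun n => ((n.+1%:R^-1 *: B n + 1) ^+ n.+1) i j) =
    (fun n => series (t n) n.+2).
  apply/funext => n; rewrite exprD1n summxE /series /= big_mkord.
  apply: eq_bigr => k _; rewrite mulmxnE mx_scaleX mxE /t exprVn -[LHS]mulr_natl mulrA //.
apply: (tannery (M := fun k => k`!%:R^-1 * (m%:R * b) ^+ k)) => //.
- move=> n k; rewrite /t normrM ler_pM ?mx_pow_bound //.
  by rewrite ger0_norm ?bin_div_le // divr_ge0 ?exprn_ge0.
- exact: cvg_exp_majorant.
- by move=> k; apply: cvgM; [exact: cvg_bin_div|exact: cvg_mx_pow].
- by move=> n; rewrite leqW // leqnSn.
Qed.

End MatrixExp.
End Limits.


Section ComplexExp.
Local Open Scope classical_set_scope.
Local Open Scope complex_scope.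
Variable R : realType.

Lemma cvg_real_complex (u : nat -> R) (l : R) :
  u n @[n --> \oo] --> l ->
  ((u n)%:C : (R[i] : numFieldType)) @[n --> \oo] -->
    (l%:C : (R[i] : numFieldType)).
Proof.
move=> ul; apply/cvgrPdist_le => -[e1 e2] /=; rewrite ltcE /= => /andP[e2_0 e1_gt0].
move/cvgrPdist_le : ul => /(_ _ e1_gt0); apply: filterS => n un.
by rewrite -rmorphB /= normc_def /= expr0n addr0 sqrtr_sqr lecE /= e2_0.
Qed.

Lemma cvg_mx_coord (K : numFieldType) m n (M : nat -> 'M[K]_(m, n)) (L : 'M[K]_(m, n)) :
  (forall i j, M k i j @[k --> \oo] --> L i j) -> M k @[k --> \oo] --> L.
Proof.
move=> ML A [P LP sPA].
have : \forall k \near \oo, forall ij : 'I_m * 'I_n, P ij.1 ij.2 (M k ij.1 ij.2).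
  by apply: filter_forall => ij; exact: (ML ij.1 ij.2 _ (LP ij.1 ij.2)).
by apply: filterS => k Pk; apply: sPA => i j; exact: (Pk (i, j)).
Qed.

(** For a real matrix, the exponential defined over the complex numbers reduces
    to real series, entry by entry. *)
Theorem expmx_real m (A : 'M[R]_m) :
  expmx (map_mx (real_complex R) A) =
  map_mx (real_complex R) (\matrix_(i, j) limn (series (exp_term A i j))).
Proof.
apply: cvg_lim; first exact: norm_hausdorff.
apply: cvg_mx_coord => i j; rewrite !mxE.
have -> : (fun n => series (fun k => (k`!%:R)^-1 *: map_mx (real_complex R) A ^+ k) n i j)
    = (fun n => (series (exp_term A i j) n)%:C).
  apply/funext => n; rewrite /series /= summxE rmorph_sum; apply: eq_bigr => k _.
  rewrite !mxE /exp_term rmorphM /= fmorphV rmorph_nat; congr (_ * _).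
  suff -> : map_mx (real_complex R) A ^+ k = map_mx (real_complex R) (A ^+ k).
    by rewrite mxE.
  elim: k => [|k IH]; first by rewrite !expr0 map_mx1.
  by rewrite !exprS IH map_mxM.
apply: cvg_real_complex; exact: cvg_exp_term.
Qed.

End ComplexExp.

(** * The Trotter product formula *)

Section Derivatives.
Local Open Scope classical_set_scope.
Variable R : realType.

(** Squeezed between [c] and [c / (1 - c / n.+1)], both from [1 + x <= expR x], the
    latter at [- c / n.+1]. *)
Lemma cvg_expR_diff (c : R) :
  n.+1%:R * (expR (c / n.+1%:R) - 1) @[n --> \oo] --> c.
Proof.
have c0 : (c * n.+1%:R^-1 : R) @[n --> \oo] --> (0 : R).
  by rewrite -(mulr0 c); apply: cvgMr; exact: cvg_invS.
apply: (squeeze_cvgr (f := fun=> c) (h := fun n => c / (1 - c / n.+1%:R))).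
- near=> n.
  have n_gt0 : 0 < n.+1%:R :> R by rewrite ltr0n.
  have x1 : c / n.+1%:R < 1.
    by near: n; exact: (cvgr_lt 0).
  set x := c / n.+1%:R in x1 *.
  have -> : c = n.+1%:R * x by rewrite /x mulrC divfK // gt_eqF.
  rewrite -mulrA !ler_pM2l //; apply/andP; split.
    by rewrite lerBrDl expR_ge1Dx.
  have x1' : 0 < 1 - x by rewrite subr_gt0.
  have -> : x / (1 - x) = (1 - x)^-1 - 1 by field; rewrite gt_eqF.
  rewrite lerD2r -[expR x]invrK -expRN lef_pV2 ?posrE ?expR_gt0 //.
  exact: expR_ge1Dx.
- exact: cvg_cst.
- rewrite -[X in _ --> X](_ : c * (1 - 0)^-1 = c); last by rewrite subr0 invr1 mulr1.
  apply: cvgMr; apply: cvgV; first by rewrite subr0 oner_neq0.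
  by apply: cvgB => //; exact: cvg_cst.
Unshelve. all: by end_near. Qed.

(** The derivative of a product at [0], along [1 / n.+1]. *)
Lemma cvg_prod_diff (I : eqType) (r : seq I) (p e : I -> R) : uniq r ->
  n.+1%:R * (\prod_(i <- r) (p i + e i / n.+1%:R) - \prod_(i <- r) p i) @[n --> \oo]
  --> \sum_(i <- r) e i * \prod_(j <- r) (if j == i then 1 else p j).
Proof.
elim: r => [_|i r IH /andP[ir /IH {}IH]].
  have -> : (fun n => n.+1%:R * (\prod_(i <- [::]) (p i + e i / n.+1%:R) -
      \prod_(i <- [::]) p i)) = (fun=> 0).
    by apply/funext => n; rewrite !big_nil subrr mulr0.
  by rewrite big_nil; exact: cvg_cst.
have -> : \sum_(k <- i :: r) e k * \prod_(j <- i :: r) (if j == k then 1 else p j)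
    = e i * \prod_(j <- r) p j +
      p i * \sum_(k <- r) e k * \prod_(j <- r) (if j == k then 1 else p j).
  rewrite !big_cons eqxx mul1r; congr (e i * _ + _).
    apply: eq_big_seq => j jr; case: eqP => // ji; by rewrite -ji jr in ir.
  rewrite mulr_sumr; apply: eq_big_seq => k kr; rewrite big_cons ifN; first by ring.
  by apply: contraNneq ir => ->.
have -> : (fun n => n.+1%:R * (\prod_(j <- i :: r) (p j + e j / n.+1%:R)
      - \prod_(j <- i :: r) p j)) =
    (fun n => e i * \prod_(j <- r) (p j + e j / n.+1%:R) +
      p i * (n.+1%:R * (\prod_(j <- r) (p j + e j / n.+1%:R) - \prod_(j <- r) p j))).
  apply/funext => n; rewrite !big_cons.
  have : (n.+1%:R : R) != 0 by rewrite pnatr_eq0.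
  by move: n.+1%:R => N N0; field.
apply: cvgD; last exact: cvgMr.
apply: cvgMr; apply: cvg_prodr => j; rewrite -[X in _ --> X]addr0 -(mulr0 (e j)).
by apply: cvgD; [exact: cvg_cst|apply: cvgMr; exact: cvg_invS].
Qed.

End Derivatives.

Section Trotter.
Local Open Scope classical_set_scope.
Local Open Scope complex_scope.
Variables (R : realType) (I : finType).
Variables (beta : R) (H : config I -> R) (h : I -> R).

(** The entries of [- beta] times the Hamiltonian. They are real, and those off the
    diagonal are nonnegative when [beta] and [h] are: this is what makes the
    thermal state a limit of classical systems. *)
Definition generator : 'M[R]_#|config I| := \matrix_(a, b)
  (- (beta * H (conf a)) * (a == b)%:R +
   \sum_i beta * h i * \prod_j
     (if j == i then conf a j != conf b j else conf a j == conf b j)%:R).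

Lemma generatorE : - beta%:C *: hamiltonian H h = map_mx (real_complex R) generator.
Proof.
apply/matrixP => a b; rewrite !mxE !rmorphD /= summxE.
rewrite mulrBr; congr (_ + _).
  by rewrite -[_ *+ _]mulr_natr [RHS]rmorphM rmorphN rmorphM rmorph_nat mulrA !mulNr.
rewrite mulNr opprK mulr_sumr rmorph_sum; apply: eq_bigr => i _.
rewrite !mxE mulrA [in RHS]rmorphM [in RHS]rmorphM rmorph_prod; congr (_ * _).
apply: eq_bigr => j _; case: (j == i); rewrite !mxE rmorph_nat.
  by rewrite (inj_eq spin_index_inj).
by rewrite (inj_eq spin_index_inj).
Qed.

Definition trotter_step n : 'M[R]_#|config I| :=
  transfer H (beta / n.+1%:R) (fun i => beta * h i / n.+1%:R).

Lemma prod_eq_conf (a b : 'I_#|config I|) :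
  \prod_(i : I) ((conf a i == conf b i)%:R : R) = (a == b)%:R.
Proof.
case: eqVneq => [->|ab]; first by rewrite big1 // => i _; rewrite eqxx.
have [i ci] : exists i, conf a i != conf b i.
  apply/existsP; apply: contra_neqT ab; rewrite negb_exists => /forallP e.
  by apply: enum_val_inj; apply/ffunP => j; have /negPn/eqP := e j.
by rewrite (bigD1 i) //= (negbTE ci) mul0r.
Qed.

(** One step is the identity plus [generator / n.+1], up to [o(1 / n.+1)]. *)
Theorem trotter a b :
  ((trotter_step n) ^+ n.+1) a b @[n --> \oo] --> limn (series (exp_term generator a b)).
Proof.
pose B n : 'M[R]_#|config I| := n.+1%:R *: (trotter_step n - 1).
have -> : (fun n => ((trotter_step n) ^+ n.+1) a b) =
    (fun n => ((n.+1%:R^-1 *: B n + 1) ^+ n.+1) a b).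
  apply/funext => n; rewrite /B scalerA mulVf ?pnatr_eq0 // scale1r.
  by rewrite subrK.
apply: cvg_mx_euler => {}a {}b.
pose p i : R := (conf a i == conf b i)%:R.
pose e i : R := (conf a i != conf b i)%:R * (beta * h i).
pose pr n := \prod_(i : I) (p i + e i / n.+1%:R).
pose c := - (beta * H (conf a)).
have pr_cvg : pr n @[n --> \oo] --> ((a == b)%:R : R).
  rewrite -prod_eq_conf; apply: cvg_prodr => i.
  rewrite -[X in _ --> X]addr0 -(mulr0 (e i)).
  by apply: cvgD; [exact: cvg_cst|apply: cvgMr; exact: cvg_invS].
have -> : (fun n => B n a b) = (fun n =>
    n.+1%:R * (expR (c / n.+1%:R) - 1) * pr n +
    n.+1%:R * (pr n - \prod_i p i)).
  apply/funext => n; rewrite !mxE -[_ * _ * pr n]mulrA -[RHS]mulrDr; congr (_ * _).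
  rewrite prod_eq_conf mulrBl mul1r subrKA; congr (expR _ * _ - _).
    by rewrite /c !mulNr mulrAC.
  apply: eq_bigr => i _; rewrite /hop /p /e.
  by case: eqP => _; rewrite ?mul0r ?mul1r ?addr0 ?add0r.
rewrite mxE; apply: cvgD.
  by apply: cvgM => //; exact: cvg_expR_diff.
have -> : \sum_i beta * h i * \prod_j
     (if j == i then conf a j != conf b j else conf a j == conf b j)%:R =
   \sum_i e i * \prod_j (if j == i then 1 else p j).
  apply: eq_bigr => i _; rewrite (bigD1 i) //= [in RHS](bigD1 i) //= eqxx.
  rewrite /e mul1r mulrCA mulrA; congr (_ * _).
  by apply: eq_bigr => j /negbTE ->.
by apply: cvg_prod_diff; exact: index_enum_uniq.
Qed.

End Trotter.

(** * From trajectories to the quantum state *)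

Lemma mx_pow_ge0 (R : realType) m (M : 'M[R]_m) k :
  (forall i j, 0 <= M i j) -> forall i j, 0 <= (M ^+ k) i j.
Proof.
move=> M_ge0; elim: k => [|k IH] i j; first by rewrite expr0 mxE ler0n.
by rewrite exprS mxE sumr_ge0 // => l _; rewrite mulr_ge0.
Qed.

Lemma mx_pow_diag_ge (R : realType) m (M : 'M[R]_m) a k :
  (forall i j, 0 <= M i j) -> M a a ^+ k <= (M ^+ k) a a.
Proof.
move=> M_ge0; elim: k => [|k IH]; first by rewrite !expr0 mxE eqxx.
rewrite !exprS mxE (bigD1 a) //= ler_wpDr ?ler_wpM2l //.
by rewrite sumr_ge0 // => l _; rewrite mulr_ge0 ?mx_pow_ge0.
Qed.

Section Quantum.
Local Open Scope classical_set_scope.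
Local Open Scope complex_scope.
Variables (R : realType) (I : finType).
Variables (beta : R) (H : config I -> R) (h : I -> R).

(** The diagonal of the exponential of [- beta] times the Hamiltonian: diagonal
    observables only see this classical weight. *)
Definition boltzmann a : R := limn (series (exp_term (generator beta H h) a a)).

Lemma qaverage_observable f :
  qaverage beta (hamiltonian H h) (observable f) =
  ((\sum_a boltzmann a * f (conf a)) / \sum_a boltzmann a)%:C.
Proof.
rewrite /qaverage generatorE expmx_real [RHS]rmorphM fmorphV; congr (_ / _).
  rewrite /mxtrace rmorph_sum; apply: eq_bigr => a _.
  by rewrite mul_diag_mx !mxE [RHS]rmorphM mulrC.
by rewrite /mxtrace rmorph_sum; apply: eq_bigr => a _; rewrite !mxE.
Qed.

Lemma normc_real (x : R) : ComplexField.Normc.normc (x%:C) = `|x|.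
Proof. by rewrite /= expr0n addr0 sqrtr_sqr. Qed.

Hypothesis beta_ge0 : 0 <= beta.
Hypothesis h_ge0 : forall i, 0 <= h i.

Let eps n i := beta * h i / n.+1%:R.

Let eps_ge0 n i : 0 <= eps n i.
Proof. by rewrite divr_ge0 ?mulr_ge0. Qed.

Lemma step_ge0 n a b : 0 <= trotter_step beta H h n a b.
Proof.
rewrite mxE mulr_ge0 ?expR_ge0 // prodr_ge0 // => i _; apply: hop_ge0.
exact: eps_ge0.
Qed.

(** The trajectories that never jump already contribute [expR (- beta * H)]. *)
Lemma boltzmann_gt0 a : 0 < boltzmann a.
Proof.
apply: lt_le_trans (expR_gt0 (- (beta * H (conf a)))) _.
have c : (trotter_step beta H h n ^+ n.+1) a a @[n --> \oo] --> boltzmann a.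
  exact: trotter.
rewrite -(cvg_lim _ c) //; apply: limr_ge.
  by apply/cvg_ex; eexists; exact: c.
near=> n; apply: le_trans (mx_pow_diag_ge a n.+1 (step_ge0 n)).
rewrite mxE big1 => [|i _]; last by rewrite /hop eqxx.
rewrite mulr1 -expRM_natl ler_expR le_eqVlt; apply/orP; left; apply/eqP.
have : (n.+1%:R : R) != 0 by rewrite pnatr_eq0.
by move: n.+1%:R => N N0; field.
Unshelve. all: by end_near. Qed.

Lemma boltzmann_sum_gt0 : 0 < \sum_a boltzmann a.
Proof.
have x0 : 'I_#|config I| := enum_rank [ffun=> true].
rewrite (bigD1 x0) //= ltr_pwDl ?boltzmann_gt0 // sumr_ge0 // => a _.
exact/ltW/boltzmann_gt0.
Qed.

Lemma qtruncatedE f g :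
  qtruncated beta (hamiltonian H h) (observable f) (observable g) =
  (cov boltzmann (f \o conf (I := I)) (g \o conf (I := I)) /
   (\sum_a boltzmann a) ^+ 2)%:C.
Proof.
have fg : observable f *m observable g = observable (fun s => f s * g s).
  apply/matrixP => a b; rewrite mul_diag_mx !mxE [(f _ * _)%:C]rmorphM.
  by rewrite mulrnAr.
have Z0 : \sum_a boltzmann a != 0 by rewrite gt_eqF // boltzmann_sum_gt0.
rewrite /qtruncated fg !qaverage_observable -rmorphM -rmorphB; congr (_%:C).
by rewrite /cov /=; field.
Qed.

Variables (C : R) (near : rel I).
Hypothesis H_C : forall i, supnorm (nabla i H) <= C.
Hypothesis H_near : forall i j s u v t, i != j -> ~~ near i j ->
  H (upd (upd s j t) i u) - H (upd (upd s j t) i v) =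
  H (upd s i u) - H (upd s i v).

(** The bound of [transfer_cov] is uniform in the number of time slices, so it
    survives in the limit. *)
Theorem qtruncated_le (w : I -> R) (alpha b : R) (f g : config I -> R)
    (D D' : I -> R) :
  (forall i, 0 < w i) -> alpha < 1 ->
  (forall i, \sum_(j | (j != i) && near i j)
     w j * (expR (2 * beta * C) - 1) <= alpha * w i) ->
  osc_bound f D -> osc_bound g D' -> (forall i, D' i <= b * w i) ->
  ComplexField.Normc.normc
    (qtruncated beta (hamiltonian H h) (observable f) (observable g))
  <= b / (1 - alpha) * \sum_i w i * D i.
Proof.
move=> w_gt0 alpha_lt1 w_near fD gD D'b.
rewrite qtruncatedE normc_real normrM normfV [X in _ / X]ger0_norm ?sqr_ge0 //.
have Z_gt0 := boltzmann_sum_gt0.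
rewrite ler_pdivrMr ?exprn_gt0 // [leRHS]mulrC mulrA.
pose Pn n a := (trotter_step beta H h n ^+ n.+1) a a.
have Pn_cvg a : Pn n a @[n --> \oo] --> boltzmann a by exact: trotter.
have sum_cvg (u : 'I_#|config I| -> R) :
    \sum_a Pn n a * u a @[n --> \oo] --> \sum_a boltzmann a * u a.
  by apply: cvg_sumr => a _; apply: cvgMl.
have Z_cvg : \sum_a Pn n a @[n --> \oo] --> \sum_a boltzmann a.
  by apply: cvg_sumr => a _.
have cov_cvg : `|cov (Pn n) (f \o conf (I := I)) (g \o conf (I := I))| @[n --> \oo]
    --> `|cov boltzmann (f \o conf (I := I)) (g \o conf (I := I))|.
  by apply: cvg_norm; apply: cvgB; apply: cvgM => //; exact: sum_cvg.
set K := b / _; set L := \sum_i w i * D i.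
have R_cvg : (\sum_a Pn n a) ^+ 2 * K * L @[n --> \oo] -->
    (\sum_a boltzmann a) ^+ 2 * K * L.
  by apply: cvgMl; apply: cvgMl; rewrite expr2; under eq_fun do rewrite expr2;
    exact: cvgM.
rewrite -(cvg_lim _ cov_cvg) // -(cvg_lim _ R_cvg) //; apply: ler_lim.
- by apply/cvg_ex; eexists; exact: cov_cvg.
- by apply/cvg_ex; eexists; exact: R_cvg.
near=> n.
apply: (transfer_cov (tau := beta / n.+1%:R) _ (eps_ge0 n) H_C H_near w_gt0
  alpha_lt1 _ fD gD D'b).
  by rewrite divr_ge0.
move=> i; apply: le_trans (w_near i); apply: ler_sum => j _.
by rewrite divfK ?pnatr_eq0.
Unshelve. all: by end_near. Qed.

End Quantum.

(** * Geometry of the lattice *)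

Section Lattice.
Variable d : nat.
Implicit Types x y z : 'rV[int]_d.

Lemma l1distC x y : l1dist x y = l1dist y x.
Proof. by apply: eq_bigr => k _; rewrite distnC. Qed.

Lemma l1dist_triangle y x z : (l1dist x z <= l1dist x y + l1dist y z)%N.
Proof. by rewrite -big_split leq_sum // => k _; exact: leqD_dist. Qed.

Lemma l1dist_xx x : l1dist x x = 0%N.
Proof. by apply: big1 => k _; exact: distnn. Qed.

Lemma l1dist_eq0 x y : l1dist x y = 0%N -> x = y.
Proof.
move=> /eqP; rewrite sum_nat_eq0 => /forallP h; apply/rowP => k.
by apply/eqP; have := h k; rewrite implyTb absz_eq0 subr_eq0.
Qed.

(** Two cubes with [2 * n] points on each side cover the ball of radius [n]: a
    point with a coordinate equal to [n] has all the others equal to [0], so its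
    coordinates are either all less than [n], or all greater than [- n]. *)
Lemma card_l1ball (L : {fset 'rV[int]_d}) (i : L) n :
  (#|[pred j : L | (j != i) && (l1dist (val j) (val i) <= n)%N]| <= 2 * (2 * n) ^ d)%N.
Proof.
case: n => [|n].
  rewrite eq_card0 // => j; apply/negbTE/negP; rewrite inE => /andP[ji].
  by rewrite leqn0 => /eqP/l1dist_eq0/val_inj e; rewrite e eqxx in ji.
set A := [pred j | _].
pose v (j : L) k : int := val j 0 k - val i 0 k.
pose low (j : L) := [forall k, (v j k < n.+1%:Z)%R].
pose code (j : L) : {ffun 'I_d -> 'I_(2 * n).+2} := [ffun k => inord
  (absz (v j k + n.+1%:Z - (~~ low j)%:Z)%R)].
have Ev j k : j \in A -> (absz (v j k) <= n.+1)%N.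
  rewrite inE => /andP[_]; apply: leq_trans.
  by rewrite /l1dist (bigD1 k) //= leq_addr.
have highE j k : j \in A -> ~~ low j -> (- (n.+1%:Z) < v j k)%R.
  move=> jA; rewrite negb_forall => /existsP[l vl].
  case: (eqVneq k l) => [->|kl]; first by move: (v j l) vl => z; lia.
  move: jA; rewrite inE => /andP[_]; rewrite /l1dist (bigD1 l) //= (bigD1 k) //=.
  rewrite -/(v j l) -/(v j k); move: (v j l) (v j k) (\sum_(_ | _) _)%N vl.
  by move=> z z' s; lia.
have codeK j k : j \in A ->
    Posz (code j k) = v j k + n.+1%:Z - (~~ low j)%:Z.
  move=> jA; have ev := Ev j k jA.
  have lo : (0 <= v j k + n.+1%:Z - (~~ low j)%:Z)%R.
    case: (boolP (low j)) => [_|/(highE j k jA)]; move: (v j k) ev => z; lia.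
  have hi : (v j k + n.+1%:Z - (~~ low j)%:Z < (2 * n).+2%:Z)%R.
    case: (boolP (low j)) => [/forallP/(_ k)|_]; move: (v j k) ev => z; lia.
  rewrite ffunE inordK; first by rewrite gez0_abs.
  by move: (v j k + _ - _) lo hi => z; lia.
have inj : {in A &, injective (fun j => (low j, code j))}.
  move=> j j' jA j'A [elow ecode]; apply/val_inj/rowP => k.
  have := codeK j k jA; rewrite ecode codeK // elow /v.
  move: (val j 0 k) (val j' 0 k) (val i 0 k) => z z' z0; lia.
rewrite -(card_in_imset inj); apply: leq_trans (max_card _) _.
by rewrite card_prod card_bool card_ffun !card_ord mulnS.
Qed.

End Lattice.

(** * Exponential decay *)

Section Decay.
Variables (R : realType) (d : nat) (L : {fset 'rV[int]_d}).

Lemma card_neighbours (r : R) (i : L) : 0 < r ->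
  #|[pred j : L | (j != i) && ((l1dist (val j) (val i))%:R <= r)]|%:R
  <= 2 * (2 * r) ^+ d.
Proof.
move=> r_gt0; have /andP[n_le n_gt] := truncn_itv (ltW r_gt0).
set n := Num.truncn r in n_le n_gt.
have le_n (k : nat) : k%:R <= r -> (k <= n)%N.
  by move=> kr; rewrite -ltnS -(ltr_nat R) (le_lt_trans kr).
apply: le_trans (_ : _ <= (2 * (2 * n) ^ d)%:R) _.
  rewrite ler_nat; apply: leq_trans (card_l1ball i n); apply: subset_leq_card.
  by apply/fintype.subsetP => j; rewrite !inE => /andP[-> /le_n].
rewrite natrM natrX natrM ler_wpM2l // lerXn2r ?nnegrE ?mulr_ge0 ?(ltW r_gt0) //.
by rewrite ler_wpM2l.
Qed.

Variables (beta : R) (H : config L -> R) (h : L -> R) (C r delta : R).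
Hypothesis beta_ge0 : 0 <= beta.
Hypothesis h_ge0 : forall i, 0 <= h i.
Hypothesis C_ge0 : 0 <= C.
Hypothesis r_gt0 : 0 < r.
Hypothesis H_C : forall i, supnorm (nabla i H) <= C.
Hypothesis H_loc : forall (i : L) (s t : config L),
  (forall j : L, (l1dist (val j) (val i))%:R <= r -> s j = t j) ->
  nabla i H s = nabla i H t.

Definition near_site (i j : L) := (l1dist (val j) (val i))%:R <= r.

Lemma far_upd_diff i j s u v t : i != j -> ~~ near_site i j ->
  H (upd (upd s j t) i u) - H (upd (upd s j t) i v) =
  H (upd s i u) - H (upd s i v).
Proof.
move=> ij far; rewrite !upd_diff.
suff -> : nabla i H (upd (upd s j t) i v) = nabla i H (upd s i v) by [].
apply: H_loc => k k_near; have [->|ki] := eqVneq k i; first by rewrite !upd_same.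
have kj : k != j by apply: contraNneq far => <-.
by rewrite !(upd_other _ _ ki) (upd_other _ _ kj).
Qed.

Hypothesis delta_ge0 : 0 <= delta.
Hypothesis delta_r : delta * r <= 20^-1.
Hypothesis small : 5 * (2 * r) ^+ d * (expR (2 * beta * C) - 1) <= 1.

(** With the weights [w i = expR (delta * rho i)], neighbouring sites have weights
    within a factor [expR (1 / 20) <= 5 / 4] of each other, so the sum of the
    influences of the neighbours is at most
    [2 * (2 * r) ^+ d * (5 / 4) * (expR (2 * beta * C) - 1) <= 1 / 2]: Dobrushin's
    estimate applies with [alpha = 1 / 2]. *)
Lemma decay (rho : L -> nat) (f g : config L -> R) (b : R) :
  (forall i j, (rho j <= rho i + l1dist (val j) (val i))%N) ->
  (forall i, supnorm (nabla i g) <= b * expR (delta * (rho i)%:R)) ->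
  ComplexField.Normc.normc
    (qtruncated beta (hamiltonian H h) (observable f) (observable g))
  <= 2 * b * \sum_i expR (delta * (rho i)%:R) * supnorm (nabla i f).
Proof.
move=> rho_lip g_b.
have -> : 2 * b = b / (1 - 2^-1) by field.
apply: (qtruncated_le beta_ge0 h_ge0 H_C far_upd_diff) (osc_bound_supnorm f)
  (osc_bound_supnorm g) g_b => [i||i]; [exact: expR_gt0|lra|].
set c := expR _ - 1.
have c_ge0 : 0 <= c.
  by rewrite subr_ge0 -expR0 ler_expR !mulr_ge0.
have e54 : expR (delta * r) <= 5 / 4.
  apply: le_trans (_ : _ <= expR 20^-1) _; first by rewrite ler_expR.
  have := expR_ge1Dx (- 20^-1 : R); rewrite expRN => h1.
  have e_gt0 := expR_gt0 (20^-1 : R).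
  have : 19 / 20 * expR 20^-1 <= (expR 20^-1)^-1 * expR 20^-1 :> R.
    by rewrite ler_wpM2r ?(ltW e_gt0) //; lra.
  rewrite mulVf ?gt_eqF //; lra.
set w := expR (delta * (rho i)%:R).
have w_ge0 : 0 <= w by exact: expR_ge0.
apply: le_trans (_ : _ <= \sum_(j | (j != i) && near_site i j) w * (5 / 4) * c) _.
  apply: ler_sum => j /andP[_ ij]; rewrite ler_wpM2r //.
  apply: le_trans (_ : _ <= w * expR (delta * r)) _; last by rewrite ler_wpM2l.
  rewrite -expRD ler_expR -mulrDr ler_wpM2l //.
  by apply: le_trans (_ : _ <= (rho i + l1dist (val j) (val i))%:R) _;
    rewrite ?ler_nat // natrD lerD2l.
rewrite sumr_const -[leLHS]mulr_natl.
have := card_neighbours i r_gt0; rewrite -/(near_site i).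
set N := #|_|%:R => N_le.
have : N * (w * (5 / 4) * c) <= 2 * (2 * r) ^+ d * (w * (5 / 4) * c).
  by rewrite ler_wpM2r ?mulr_ge0.
have := ler_wpM2r w_ge0 small.
set y := (2 * r) ^+ d; rewrite -/c; lra.
Qed.

End Decay.

Section SetDist.
Variables (R : realType) (d : nat) (L : {fset 'rV[int]_d}).
Implicit Types A B : {set L}.

Lemma setdist_le A B i j : i \in A -> j \in B ->
  (setdist R A B <= (l1dist (val i) (val j))%:R%:E)%E.
Proof.
move=> iA jB; apply: le_trans (bigmin_le_cond _ _ iA) _.
exact: bigmin_le_cond.
Qed.

Lemma setdist_ge0 A B : (0 <= setdist R A B)%E.
Proof.
apply: le_bigmin => [|i _]; first exact: leey.
by apply: le_bigmin => [|j _]; [exact: leey|rewrite lee_fin].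
Qed.

End SetDist.

Unset Implicit Arguments.

Theorem theorem2p2 (R : realType) (d : nat) (d_ge1 : (1 <= d)%N)
  (L : {fset 'rV[int]_d}) (beta : R) (beta_gt0 : 0 < beta)
  (H : config L -> R) (lambda_ : L -> R)
  (C lambda r : R) (C_gt0 : 0 < C) (lambda_gt0 : 0 < lambda) (r_gt0 : 0 < r)
  (BD_H : forall i : L, supnorm (nabla i H) <= C)
  (BD_lambda : forall i : L, 0 <= lambda_ i <= lambda)
  (LOC : forall (i : L) (s t : config L),
     (forall j : L, (l1dist (val j) (val i))%:R <= r -> s j = t j) ->
     nabla i H s = nabla i H t) :
  let gamma := expR (- (2 * beta * C))
    - 5 * Num.max 1 (beta * lambda) * (2 * r) ^+ d * (expR (3 * beta * C) - 1) in
  let N := (2 / (1 - expR (- r^-1))) ^+ d in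
  let delta := (2 * r)^-1 *
    Num.min (2^-1)
      (gamma / (10 * Num.max 1 (lambda * beta) * expR (beta * C + 1))) in
  0 < gamma ->
  forall f g : config L -> R,
    ((ComplexField.Normc.normc
       (qtruncated beta (hamiltonian H lambda_) (observable f) (observable g)))%:E
     <= (supnorm f * supnorm g + N * trinorm f * trinorm g)%:E
        * expeR (- (delta%:E * setdist R (Lambda_ f) (Lambda_ g))))%E.
Proof.
move=> gamma N delta gamma_gt0 f g.
have bC_gt0 : 0 < beta * C by rewrite mulr_gt0.
have [M1 M2] : 1 <= Num.max 1 (beta * lambda) /\ 1 <= Num.max 1 (lambda * beta).
  by rewrite !le_max lexx.
have rd_gt0 : 0 < (2 * r) ^+ d by rewrite exprn_gt0 ?mulr_gt0.
have e3_gt0 : 0 < expR (3 * beta * C) - 1.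
  by rewrite subr_gt0 expR_gt1 -mulrA mulr_gt0.
have e2_lt1 : expR (- (2 * beta * C)) < 1.
  by rewrite expR_lt1 oppr_lt0 -mulrA mulr_gt0.
have y_gt0 := mulr_gt0 rd_gt0 e3_gt0.
have My : (2 * r) ^+ d * (expR (3 * beta * C) - 1) <=
    Num.max 1 (beta * lambda) * ((2 * r) ^+ d * (expR (3 * beta * C) - 1)).
  by rewrite ler_peMl // ltW.
have gammaE : gamma = expR (- (2 * beta * C)) -
    5 * (Num.max 1 (beta * lambda) * ((2 * r) ^+ d * (expR (3 * beta * C) - 1))).
  by rewrite /gamma; ring.
have gamma_lt1 : gamma < 1 by lra.
have small : 5 * (2 * r) ^+ d * (expR (2 * beta * C) - 1) <= 1.
  have : (2 * r) ^+ d * (expR (2 * beta * C) - 1) <=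
      (2 * r) ^+ d * (expR (3 * beta * C) - 1).
    rewrite ler_wpM2l ?(ltW rd_gt0) // lerD2r ler_expR -!mulrA.
    by rewrite ler_wpM2r ?(ltW bC_gt0) // ler_nat.
  lra.
pose q := gamma / (10 * Num.max 1 (lambda * beta) * expR (beta * C + 1)).
have e_gt1 : 1 < expR (beta * C + 1) by rewrite expR_gt1 addr_gt0.
have den : 10 <= 10 * Num.max 1 (lambda * beta) * expR (beta * C + 1).
  rewrite -mulrA ler_peMr // mulr_ege1 // ltW //.
have q_gt0 : 0 < q by rewrite divr_gt0 // (lt_le_trans _ den).
have q_le : q <= 10^-1.
  rewrite /q ler_pdivrMr ?(lt_le_trans _ den) //; lra.
have delta_ge0 : 0 <= delta.
  by rewrite mulr_ge0 ?invr_ge0 ?mulr_ge0 ?(ltW r_gt0) // le_min invr_ge0 ler0n ltW.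
(* This is where the second term of the minimum defining [delta] enters; [q] is
   at most 1/10 because [gamma < 1]. *)
have delta_r : delta * r <= 20^-1.
  have -> : delta * r = 2^-1 * Num.min 2^-1 q by rewrite /delta; field; rewrite gt_eqF.
  have : Num.min 2^-1 q <= q by rewrite ge_min lexx orbT.
  lra.
have lambda_ge0 i : 0 <= lambda_ i by have /andP[] := BD_lambda i.
have N_ge2 : 2 <= N.
  have er := expR_gt0 (- r^-1).
  have er1 : expR (- r^-1) < 1 by rewrite expR_lt1 oppr_lt0 invr_gt0.
  have t2 : 2 <= 2 / (1 - expR (- r^-1)).
    rewrite ler_pdivlMr ?subr_gt0 //; lra.
  rewrite /N -(prednK d_ge1) exprS -[leLHS]mulr1 ler_pM // exprn_ege1 //; lra.
have trinorm_ge0 (u : config L -> R) : 0 <= trinorm u.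
  by apply: sumr_ge0 => i _; exact: supnorm_ge0.
have notin_Lambda (u : config L -> R) i : i \notin Lambda_ u -> supnorm (nabla i u) = 0.
  rewrite inE -leNgt => u0; apply/eqP; rewrite eq_le u0; exact: supnorm_ge0.
have rhs_ge0 : 0 <= supnorm f * supnorm g + N * trinorm f * trinorm g.
  by rewrite addr_ge0 ?mulr_ge0 ?supnorm_ge0 ?trinorm_ge0 // (le_trans _ N_ge2).
have bound := decay (ltW beta_gt0) lambda_ge0 (ltW C_gt0) r_gt0 BD_H LOC
  delta_ge0 delta_r small.
(* When one of the supports is empty the function is constant, and the bound
   without weights vanishes. *)
case: (set_0Vmem (Lambda_ f)) => [f0|[i0 fi0]].
  have e0 : trinorm f = 0 by apply: big1 => i _; apply: notin_Lambda; rewrite f0 inE.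
  apply: le_trans (_ : _ <= 0%:E)%E _; last by rewrite mule_ge0 ?lee_fin ?expeR_ge0.
  rewrite lee_fin; apply: le_trans (bound (fun=> 0%N) f g (trinorm g) _ _) _ => //.
    move=> i; rewrite mulr0 expR0 mulr1 /trinorm (bigD1 i) //= lerDl.
    by rewrite sumr_ge0 // => j _; exact: supnorm_ge0.
  under eq_bigr do rewrite mulr0 expR0 mul1r.
  by rewrite -/(trinorm f) e0 mulr0.
case: (set_0Vmem (Lambda_ g)) => [g0|[j0 gj0]].
  have e0 : trinorm g = 0 by apply: big1 => i _; apply: notin_Lambda; rewrite g0 inE.
  apply: le_trans (_ : _ <= 0%:E)%E _; last by rewrite mule_ge0 ?lee_fin ?expeR_ge0.
  rewrite lee_fin; apply: le_trans (bound (fun=> 0%N) f g 0 _ _) _ => //.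
    by move=> i; rewrite mul0r notin_Lambda // g0 inE.
  by rewrite mulr0 mul0r.
have [D DE] : exists D : R, setdist R (Lambda_ f) (Lambda_ g) = D%:E.
  have := setdist_ge0 R (Lambda_ f) (Lambda_ g).
  have := setdist_le R fi0 gj0.
  by case: setdist => // D _ _; exists D.
(* Otherwise the weights grow with the distance to the support of [f]: they
   are 1 on that support, and at least [expR (delta * D)] on that of [g]. *)
pose near_f (i : L) := [arg min_(j < i0 in Lambda_ f) l1dist (val i) (val j)].
have near_fP i : near_f i \in Lambda_ f /\
    forall j, j \in Lambda_ f ->
      (l1dist (val i) (val (near_f i)) <= l1dist (val i) (val j))%N.
  by rewrite /near_f; case: arg_minnP.
pose rho (i : L) := l1dist (val i) (val (near_f i)).
have rho0 i : i \in Lambda_ f -> rho i = 0%N.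
  move=> fi; apply/eqP; rewrite -leqn0 -(l1dist_xx (val i)).
  exact: (near_fP i).2.
have rhoD i : i \in Lambda_ g -> D <= (rho i)%:R.
  move=> gi; rewrite -lee_fin -DE /rho l1distC.
  exact: setdist_le (near_fP i).1 gi.
rewrite DE (_ : expeR _ = (expR (- (delta * D)))%:E) // -EFinM lee_fin.
apply: le_trans (bound rho f g (trinorm g * expR (- (delta * D))) _ _) _.
- move=> i j; apply: leq_trans ((near_fP j).2 _ (near_fP i).1) _.
  by rewrite addnC; exact: l1dist_triangle.
- move=> i; rewrite -mulrA -expRD.
  case: (boolP (i \in Lambda_ g)) => [gi|/notin_Lambda ->]; last first.
    by rewrite mulr_ge0 ?expR_ge0.
  apply: le_trans (_ : _ <= trinorm g) _.
    rewrite /trinorm (bigD1 i) //= lerDl.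
    by rewrite sumr_ge0 // => j _; exact: supnorm_ge0.
  rewrite ler_peMr // -[leLHS]expR0 ler_expR addrC subr_ge0 ler_wpM2l //.
  exact: rhoD.
have -> : \sum_i expR (delta * (rho i)%:R) * supnorm (nabla i f) = trinorm f.
  apply: eq_bigr => i _; case: (boolP (i \in Lambda_ f)) => [/rho0 ->|/notin_Lambda ->].
    by rewrite mulr0 expR0 mul1r.
  by rewrite mulr0.
rewrite [leLHS](_ : _ = 2 * trinorm f * trinorm g * expR (- (delta * D))); last by ring.
rewrite ler_wpM2r ?expR_ge0 //.
apply: le_trans (_ : _ <= N * trinorm f * trinorm g) _; last first.
  by rewrite lerDr mulr_ge0 ?supnorm_ge0.
by rewrite !ler_wpM2r.
Qed.
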